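(* Let $D\ge 1$. Let $\mathbf R_n[D]$ be the $D$th random discrete feuilletage of size $n$ (a random connected graph, defined in the context). If each edge of $\mathbf R_n[D]$ is given length $1/\alpha_n^{(D)}$, the sequence of diameters of these graphs is tight as $n\to\infty$; equivalently, the sequence of random variables $n^{-1/2^D}\,\mathrm{diam}(\mathbf R_n[D])$ ($\mathrm{diam}$ being the diameter for the usual graph distance) is tight.
   Context: **Planar trees.** For a rooted planar tree $T$ with $N$ edges: its nodes in lexicographical (depth-first) order are $u_0$ (the root)$,u_1,\ldots,u_N$; its height sequence $H_T(0),\ldots,H_T(N)$ is the sequence of their depths; its depth-first traversal $c_T(0),\ldots,c_T(2N)$ is the walk around the tree starting and ending at the root (from a node go to its first not yet visited child if any, otherwise to its parent); for $0\le k\le 2N-1$, $k$ is called a corner of the node $c_T(k)$; the contour sequence is $C_T(k)=$ depth of $c_T(k)$. Contour sequences of trees with $N$ edges are exactly the Dyck paths of length $2N$ (the set $\mathsf{Dyck}_{2N}$); height sequences are exactly the elements of $\mathbb H_N=\{(H_0,\ldots,H_N): H_0=0,\ H_i-H_{i-1}\le1,\ H_i>0\text{ for }i\ge1\}$; each determines the tree. $\Phi_N^{H\to C}:\mathbb H_N\to\mathsf{Dyck}_{2N}$ maps the height sequence of a tree to its contour sequence. Branching random walk on $T$: i.i.d. variables uniform on $\{-1,0,1\}$ (independent of $T$) are attached to the non-root nodes; the label of a node is the sum of the variables along the path from the root to it (root label $0$). The label process is $L(k)=$ label of $c_T(k)$, $0\le k\le2N$. $\mathbb L_N$ is the set of sequences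 $(L_0,\ldots,L_N)$ with $L_0=L_N=0$ and increments in $\{-1,0,1\}$. $\Phi_N^{L\to H}:\mathbb L_N\to\mathbb H_N$ is $H(0)=0$, $H(j)=1+L((A+j-1)\bmod N)-L(A)$ for $1\le j\le N$, where $A=\min\operatorname{argmin}L$ is the smallest index at which $L$ attains its minimum. **Iterated discrete snakes.** $\mathbf C_n^{(1)}$ is uniform in $\mathsf{Dyck}_{2n}$; given $\mathbf C_n^{(j)}\in\mathsf{Dyck}_{2^jn}$ (and the past), $\mathbf L_n^{(j)}\in\mathbb L_{2^jn}$ is the label process of a branching random walk on the tree $\mathbf T_n^{(j)}$ with contour $\mathbf C_n^{(j)}$; for $j\ge2$, $\mathbf C_n^{(j)}=\Phi^{H\to C}_{2^{j-1}n}(\Phi^{L\to H}_{2^{j-1}n}(\mathbf L_n^{(j-1)}))$. The tree $\mathbf T_n^{(j)}$ has $N_n^{(j)}=2^{j-1}n$ edges. Set $\mathbf a_n^{(j)}=\min\operatorname{argmin}\mathbf L_n^{(j)}$, and $\alpha_n^{(j)}=(2n)^{1/2^{j}}(2/3)^{1-1/2^{j-1}}$. **Discrete feuilletage.** For $j\ge2$, the non-root node of index $k$ ($1\le k\le N_n^{(j)}$, lexicographical order) of $\mathbf T_n^{(j)}$ corresponds to the corner $(\mathbf a_n^{(j-1)}+k-1)\bmod N_n^{(j)}$ of $\mathbf T_n^{(j-1)}$ (which has $N_n^{(j)}=2N_n^{(j-1)}$ corners), hence to a node $p_j(u)$ of $\mathbf T_n^{(j-1)}$; nodes of $\mathbf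 T_n^{(j)}$ with the same image by $p_j$ are identified. The root of $\mathbf T_n^{(j)}$ is not identified with other nodes of $\mathbf T_n^{(j)}$. $\mathbf R_n[D]$ is the graph obtained from $\mathbf T_n^{(D)}$ by performing all these identifications iteratively: two nodes of $\mathbf T_n^{(D)}$ are identified if, applying $p_D,p_{D-1},\ldots$ successively until one reaches either a node of $\mathbf T_n^{(1)}$ or the root of some $\mathbf T_n^{(j)}$ with $2\le j\le D$, one obtains the same node; its edges are those of $\mathbf T_n^{(D)}$. *)

(* Defs.v *)
From HB Require Import structures.
From mathcomp Require Import all_boot all_order all_algebra.
From mathcomp Require Import all_classical all_reals all_analysis.
Import Order.TTheory GRing.Theory Num.Theory.
Import numFieldNormedType.Exports.

Set Implicit Arguments.
Unset Strict Implicit.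
Unset Printing Implicit Defensive.

Local Open Scope ring_scope.
Local Open Scope classical_set_scope.

Inductive ptree : Type := PNode of seq ptree.

HB.instance Definition _ := gen_eqMixin ptree.
HB.instance Definition _ := gen_choiceMixin ptree.

Definition leaf : ptree := PNode [::].

(* Nodes are Ulam-Harris words: [::] is the root, and rcons u i is the i-th
   child of u (counted from 0), so the depth of a node is its size. *)
Definition node := seq nat.

Definition parent (u : node) : node := take (size u).-1 u.

(* The nodes in lexicographical order; the lexicographical index of u in t is
   index u (nodes t). *)
Fixpoint nodes (t : ptree) : seq node :=
  let: PNode ts := t in
  [::] :: (fix children i ts :=
             if ts is t' :: ts'
             then map (cons i) (nodes t') ++ children i.+1 ts'
             else [::]) 0%N ts.

(* The depth-first traversal c_t(0), ..., c_t(2N): from a node, walk around the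
   subtree of each child in turn, coming back to the node after each of them. *)
Fixpoint traversal (t : ptree) : seq node :=
  let: PNode ts := t in
  [::] :: (fix children i ts :=
             if ts is t' :: ts'
             then map (cons i) (traversal t') ++ [::] :: children i.+1 ts'
             else [::]) 0%N ts.

Definition nb_edges (t : ptree) : nat := (size (nodes t)).-1.

Definition heights (t : ptree) : seq nat := map size (nodes t).

Definition contour (t : ptree) : seq nat := map size (traversal t).

Definition is_dyck (n : nat) (c : seq nat) : bool :=
  [&& size c == n.*2.+1, head 0%N c == 0%N, last 0%N c == 0%N
    & sorted (fun a b : nat => (b == a.+1) || (a == b.+1)) c].

(* A Dyck path of length 2n never exceeds n, so this counts all of them. *)
Definition nb_dyck (n : nat) : nat :=
  #|[pred c : (n.*2.+1).-tuple 'I_n.+1 | is_dyck n (map val c)]|.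

(* The tree with a given contour (resp. height) sequence; the value leaf is
   taken only on sequences that are not contour (resp. height) sequences. *)
Definition tree_of_contour (c : seq nat) : ptree :=
  xget leaf [set t | contour t = c].

Definition tree_of_heights (h : seq nat) : ptree :=
  xget leaf [set t | heights t = h].

Definition phi_HC (h : seq nat) : seq nat := contour (tree_of_heights h).

(* The smallest index at which l attains its minimum. *)
Definition min_argmin (l : seq int) : nat :=
  find (fun x => all (fun y => x <= y) l) l.

(* Here N = (size l).-1; the entries 1 + L(.) - L(A) are positive, so taking
   absolute values is only a cast to nat. *)
Definition phi_LH (l : seq int) : seq nat :=
  let N := (size l).-1 in
  let A := min_argmin l in
  let lab (i : nat) : int := nth 0 l i in
  0%N :: [seq absz (1 + lab ((A + j - 1) %% N)%N - lab A)%R | j <- iota 1 N].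

(* xi k is the variable attached to the node of lexicographical index k; the
   words take i u, 1 <= i <= size u, are the non-root nodes on the path from
   the root to u. *)
Definition node_label (t : ptree) (xi : nat -> int) (u : node) : int :=
  \sum_(1 <= i < (size u).+1) xi (index (take i u) (nodes t)).

Definition label_process (t : ptree) (xi : nat -> int) : seq int :=
  map (node_label t xi) (traversal t).

Definition snake_size (n j : nat) : nat := (2 ^ j.-1 * n)%N.

(* The iterated discrete snakes of size n, realized on a probability space;
   only the values at levels j >= 1 are meaningful. The field snake_lawE says
   that C^(1) is uniform on Dyck paths of length 2n, that the variables
   attached to the non-root nodes are i.i.d. uniform on {-1, 0, 1} at each
   level, and that C^(1) and the families of all levels are independent. *)
Record iterated_snakes (R : realType) (d : measure_display)
    (Om : measurableType d) (P : probability Om R) (n : nat) := IteratedSnakes {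
  snake_contour : nat -> Om -> seq nat;
  snake_step : nat -> nat -> Om -> int;
  snake_label : nat -> Om -> seq int;
  snake_contour_measurable : forall c,
    measurable [set w | snake_contour 1 w = c];
  snake_step_measurable : forall j k x,
    measurable [set w | snake_step j k w = x];
  snake_lawE : forall (J : nat) (c : seq nat) (x : nat -> nat -> int),
    is_dyck n c ->
    (forall j k, x j k \in [:: -1; 0; 1]) ->
    P [set w | snake_contour 1 w = c /\
               forall j k, (1 <= j <= J)%N -> (1 <= k <= snake_size n j)%N ->
                 snake_step j k w = x j k]
    = ((nb_dyck n)%:R^-1 *
       \prod_(1 <= j < J.+1) (3%:R^-1) ^+ snake_size n j)%:E;
  snake_labelE : forall j w, (1 <= j)%N ->
    snake_label j w = label_process (tree_of_contour (snake_contour j w))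
                                    (fun k => snake_step j k w);
  snake_contourE : forall j w, (2 <= j)%N ->
    snake_contour j w = phi_HC (phi_LH (snake_label j.-1 w))
}.

Definition snake_tree (R : realType) (d : measure_display)
    (Om : measurableType d) (P : probability Om R) (n : nat)
    (S : iterated_snakes P n) (j : nat) (w : Om) : ptree :=
  tree_of_contour (snake_contour S j w).

Record fgraph := FGraph { vertex : finType; edge : rel vertex }.

Definition walk_of_length (G : fgraph) (k : nat) (x y : vertex G) : bool :=
  [exists p : k.-tuple (vertex G), path (@edge G) x p && (last x p == y)].

(* The length of a shortest path, which is less than #|vertex G| when there is
   one. *)
Definition gdist (G : fgraph) (x y : vertex G) : nat :=
  find (fun k => walk_of_length k x y) (iota 0 #|vertex G|).

Definition diam (G : fgraph) : nat :=
  \max_(x : vertex G) \max_(y : vertex G) gdist x y.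

Section Feuilletage.
Variables (T : nat -> ptree) (L : nat -> seq int).

(* The node p_j(u) of T^(j-1), for u a non-root node of T^(j). *)
Definition fold_node (j : nat) (u : node) : node :=
  nth [::] (traversal (T j.-1))
    ((min_argmin (L j.-1) + index u (nodes (T j)) - 1) %% nb_edges (T j)).

(* Applies p_j, p_(j-1), ... to the node u of T^(j), and stops at a node of
   T^(1) or at the root of some T^(i), i >= 2. The result is tagged with the
   level at which it lives. *)
Fixpoint fold_class (j : nat) (u : node) : nat * node :=
  match j with
  | (_.+1 as j').+1 =>
      if u == [::] then (j, u) else fold_class j' (fold_node j u)
  | _ => (j, u)
  end.

Definition feuilletage_vertices (D : nat) : seq (nat * node) :=
  map (fold_class D) (nodes (T D)).

Definition feuilletage_edge (D : nat) : rel (nat * node) := fun x y =>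
  has (fun u => (u != [::]) &&
         (((x, y) == (fold_class D u, fold_class D (parent u))) ||
          ((y, x) == (fold_class D u, fold_class D (parent u)))))
      (nodes (T D)).

Definition feuilletage (D : nat) : fgraph :=
  @FGraph (seq_sub (feuilletage_vertices D))
          (fun x y => feuilletage_edge D (val x) (val y)).

End Feuilletage.

Definition random_feuilletage (R : realType) (d : measure_display)
    (Om : measurableType d) (P : probability Om R) (n : nat)
    (S : iterated_snakes P n) (D : nat) (w : Om) : fgraph :=
  feuilletage (snake_tree S ^~ w) (snake_label S ^~ w) D.

Definition alpha (R : realType) (n j : nat) : R :=
  (2 * n%:R) `^ (2 ^+ j)^-1 * (2 / 3) `^ (1 - (2 ^+ j.-1)^-1).

(* Tightness of real random variables, possibly living on different spaces. *)
Definition tight (R : realType) (d : nat -> measure_display)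
    (Om : forall n, measurableType (d n)) (P : forall n, probability (Om n) R)
    (X : forall n, Om n -> R) : Prop :=
  forall e : R, 0 < e ->
    exists2 K : set R, compact K &
      forall n, (P n (X n @^-1` (~` K)) <= e%:E)%E.

(* Main.v *)
Require Import Defs.
From HB Require Import structures.
From mathcomp Require Import all_boot all_order all_algebra.
From mathcomp Require Import all_classical all_reals all_analysis.
From mathcomp Require Import ring lra zify.
Import Order.TTheory GRing.Theory Num.Theory.
Import numFieldNormedType.Exports.

Set Implicit Arguments.
Unset Strict Implicit.
Unset Printing Implicit Defensive.

Local Open Scope ring_scope.

(** A walk to the root bounds the diameter of the feuilletage by twice the
    height of T^(D), so it suffices to control contour processes. At level j
    one proves, uniformly in n, a dyadic Hoelder bound with constant
    K (2^I)^(1/2^j), where 2^I is of order n, and some positive exponent that is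
    divided by 4 at each level. Given the tree, the label increment between two
    corners is a sum of i.i.d. steps along the tree path joining them, whose
    length is controlled by the contour; exponential moments and chaining then
    give the Hoelder bound for the labels. The next height process is the label
    process up to a cyclic shift, and the oscillations of a contour are at most
    twice those of the heights, up to 1. The first level is the same chaining
    argument for a uniform Dyck path: by the cycle lemma it is a rotation of a
    uniform bridge, which is absolutely continuous, with bounded density, with
    respect to the simple random walk on at most half of its length. All laws
    being uniform, probabilities are proportions in lists of outcomes. *)

(** * Words and exponential moments *)

(** Labels along a tree path of length h fluctuate by the square root of h, so passing to the next
    level takes the square root of the Hoelder bound: this halves both the exponent of n and the
    Hoelder exponent. Chaining concedes half of what remains of the latter, to pay for a union bound
    over all dyadic increments; hence the power 4 in [rateS] against the power 2 in [scaleS]. Two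
    things threaten the recursion at small scales: exponential moments are controlled only for
    bounded parameters, and the passage from heights to contours adds constants. Both are absorbed
    because the target bound never drops below 1 ([scale_rate_pow_ge1]). The label estimate is
    proved for each fixed tree with a Hoelder contour, so conditioning amounts to appending one more
    word of letters to an outcome. A sequence that codes no tree is decoded as [leaf], whose contour
    satisfies every bound. *)

Fixpoint words (A : seq int) (q : nat) : seq (seq int) :=
  if q is q'.+1 then [seq a :: w | a <- A, w <- words A q'] else [:: [::]].

Lemma size_words A q : size (words A q) = (size A ^ q)%N.
Proof. by elim: q => //= q IH; rewrite size_allpairs IH expnS. Qed.

Lemma mem_words A q w : (w \in words A q) = (size w == q) && all (mem A) w.
Proof.
elim: q w => [|q IH] [|a w] //=.
- by apply/negbTE/allpairsP => -[[x y] /= [_ _]].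
- rewrite eqSS; apply/allpairsP/idP => [[[x y] /= [xA yw [-> ->]]]|].
    by move: yw; rewrite IH xA => /andP[-> ->].
  by case/and3P=> sw aA wA; exists (a, w); rewrite /= IH sw aA wA.
Qed.

Lemma uniq_words A q : uniq A -> uniq (words A q).
Proof.
move=> uA; elim: q => //= q IH; apply: allpairs_uniq => //.
by move=> [a w] [a' w'] _ _ /= [-> ->].
Qed.

(** Independence of the letters of a uniform word, in unnormalized form. *)
Lemma sum_words_prod (R : comNzRingType) A q (F : nat -> int -> R) :
  \sum_(w <- words A q) \prod_(i < q) F i w`_i
  = \prod_(i < q) \sum_(a <- A) F i a.
Proof.
elim: q F => [|q IH] F /=; first by rewrite big_seq1 !big_ord0.
rewrite big_allpairs_dep /= big_ord_recl mulr_suml.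
apply: eq_bigr => a _; rewrite -(IH (fun i => F i.+1)) mulr_sumr.
by apply: eq_bigr => w _; rewrite big_ord_recl.
Qed.

Lemma big_uniq_ord (R : nmodType) q (ks : seq nat) (F : nat -> R) :
  uniq ks -> (forall k, k \in ks -> (k < q)%N) ->
  \sum_(k <- ks) F k = \sum_(i < q | (i : nat) \in ks) F i.
Proof.
move=> uks ksq; rewrite -(big_mkord (fun k => k \in ks)) -big_filter.
apply: perm_big; apply: uniq_perm => //; first exact/filter_uniq/iota_uniq.
move=> k; rewrite mem_filter mem_index_iota /=.
by case: (boolP (k \in ks)) => // /ksq ->.
Qed.

Section ExponentialMoments.
Variable R : realType.
Implicit Types (u theta : R).

(** Invert [1 + x <= expR x] at x = -(u - 2u^2): the claim reduces to (1 + u)(1 - u + 2u^2) = 1 +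
    u^2 (1 + 2u) being at least 1. *)
Lemma expR_sub_sqr_le u : - 2^-1 <= u -> expR (u - 2 * u ^+ 2) <= 1 + u.
Proof.
move=> hu; have h := expR_ge1Dx (- (u - 2 * u ^+ 2)).
have pos : 0 < 1 + - (u - 2 * u ^+ 2) by nra.
rewrite -[u - _]opprK expRN -(invrK (1 + u)).
have u1 : 0 < 1 + u by lra.
rewrite lef_pV2 ?posrE ?expR_gt0 ?invr_gt0 //; apply: le_trans h.
rewrite -[_^-1]mul1r ler_pdivrMr //; nra.
Qed.

(* The product of the [1 + u_k w_k] has mean 1 and dominates the exponential
   up to the factor [exp (2 u_k^2)] for each [k]. *)
Lemma sum_words_expR_le A q (ks : seq nat) theta :
  (forall a, a \in A -> a \in [:: -1; 0; 1]) -> \sum_(a <- A) a = 0 ->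
  uniq ks -> (forall k, k \in ks -> (k < q)%N) -> `|theta| <= 2^-1 ->
  \sum_(w <- words A q) expR (theta * (\sum_(k <- ks) w`_k)%:~R)
  <= expR (2 * theta ^+ 2 * (size ks)%:R) * (size A)%:R ^+ q.
Proof.
move=> hA A0 uks ksq ht.
(* Vanishing off [ks], [u] lets the product run over all coordinates. *)
pose u (i : nat) : R := if i \in ks then theta else 0.
have uE i : `|u i| <= 2^-1 by rewrite /u; case: ifP => // _; rewrite normr0; lra.
pose F (i : nat) (a : int) : R := (1 + u i * a%:~R) * expR (2 * u i ^+ 2).
apply: (@le_trans _ _ (\sum_(w <- words A q) \prod_(i < q) F i w`_i)).
  rewrite big_seq [leRHS]big_seq; apply: ler_sum => w.
  rewrite mem_words => /andP[/eqP sw /allP wA].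
  rewrite (big_uniq_ord (fun k => w`_k) uks ksq) big_mkcond /=.
  rewrite rmorph_sum /= mulr_sumr expR_sum.
  apply: ler_prod => i _; rewrite expR_ge0 /=.
  have wi : w`_i \in [:: -1; 0; 1] by apply/hA/wA/mem_nth; rewrite sw.
  have -> : theta * (if (i : nat) \in ks then w`_i else 0)%:~R = u i * (w`_i)%:~R.
    by rewrite /u; case: ifP => //; rewrite mulr0 mul0r.
  have /ler_normlP[h1 h2] := uE i.
  rewrite /F; set v := u i * _.
  have [v1 v2] : - 2^-1 <= v /\ v ^+ 2 <= u i ^+ 2.
    rewrite /v; move: wi; rewrite !inE => /or3P[] /eqP -> /=;
    rewrite ?mulrN1z ?mulr1z ?mulr0z; split; nra.
  rewrite -[v](subrK (2 * v ^+ 2)) expRD subrK.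
  apply: ler_pM; rewrite ?expR_ge0 //; first exact: expR_sub_sqr_le.
  by rewrite ler_expR; lra.
rewrite (sum_words_prod A q F).
have -> : \prod_(i < q) \sum_(a <- A) F i a
    = \prod_(i < q) ((size A)%:R * expR (2 * u i ^+ 2)).
  apply: eq_bigr => i _; rewrite -mulr_suml; congr (_ * _).
  rewrite big_split /= -mulr_sumr -rmorph_sum /= A0 mulr0 addr0.
  by rewrite big_const_seq count_predT iter_addr_0.
rewrite big_split /= prodr_const card_ord mulrC -expR_sum.
rewrite ler_wpM2r ?exprn_ge0 //.
rewrite ler_expR -mulr_sumr -mulrA ler_pM2l ?ltr0n //.
rewrite mulr_natr -[theta ^+ 2 *+ _]iter_addr_0 -count_predT -big_const_seq.
rewrite (big_uniq_ord (fun=> theta ^+ 2) uks ksq) [leRHS]big_mkcond /=.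
by apply: ler_sum => i _; rewrite /u; case: ifP => //; rewrite expr0n.
Qed.

End ExponentialMoments.

(** * Chaining *)

Section Chaining.
Variable R : realType.
Implicit Types (f : nat -> int) (X r : R).

(* Hoelder continuity on [0, M] read at dyadic scales: for r = 2^(-b) the
   exponent is b. *)
Definition holder f (M I : nat) X r : Prop :=
  forall i s t, (i <= I)%N -> (s <= t <= M)%N -> (t - s <= 2 ^ i)%N ->
  `|(f t - f s)%:~R| <= X * r ^+ (I - i).

(** Rounding a point down to scale i passes through all finer scales and costs the geometric sum
    r/(1-r) in units of the scale-i bound. Two points at distance at most 2^i have equal or adjacent
    roundings, so the total is 2r/(1-r) + 1 = (1+r)/(1-r). *)
Lemma dyadic_holder f M I X r : 0 <= X -> 0 < r < 1 ->
  (forall i k, (i <= I)%N -> (k.+1 * 2 ^ i <= M)%N ->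
    `|(f (k.+1 * 2 ^ i)%N - f (k * 2 ^ i)%N)%:~R| <= X * r ^+ (I - i)) ->
  holder f M I (X * (2 / (1 - r))) r.
Proof.
move=> X0 /andP[r0 r1] hf; have r1' : 0 < 1 - r by lra.
have fl i s : (i <= I)%N -> (s <= M)%N ->
    `|(f s - f (s %/ 2 ^ i * 2 ^ i)%N)%:~R| <= X * r ^+ (I - i) * (r / (1 - r)).
  elim: i s => [|i IH] s iI sM.
    rewrite expn0 divn1 muln1 subrr normr0 !mulr_ge0 ?exprn_ge0 ?invr_ge0 //; lra.
  have {}IH := IH s (ltnW iI) sM.
  have rS : r ^+ (I - i) = r * r ^+ (I - i.+1) by rewrite -exprS subnSK.
  (* Between consecutive scales the rounding moves by one dyadic increment or not at all, according
     to the parity of s / 2^i. *)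
  have step : `|(f (s %/ 2 ^ i * 2 ^ i)%N - f (s %/ 2 ^ i.+1 * 2 ^ i.+1)%N)%:~R|
      <= X * r ^+ (I - i).
    set a := (s %/ 2 ^ i)%N.
    have -> : (s %/ 2 ^ i.+1 * 2 ^ i.+1 = (a./2).*2 * 2 ^ i)%N.
      by rewrite expnSr divnMA -/a divn2 -muln2 mulnA mulnAC.
    have [ao|ae] := boolP (odd a); last first.
      rewrite halfK (negbTE ae) subn0 subrr normr0 mulr_ge0 ?exprn_ge0 //; lra.
    have aE : a = (a./2).*2.+1 by rewrite -[LHS]odd_double_half ao.
    rewrite {1}aE; apply: hf => //; first exact: ltnW.
    by rewrite -aE (leq_trans _ sM) // leq_divM.
  have -> : f s - f (s %/ 2 ^ i.+1 * 2 ^ i.+1)%N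
     = (f s - f (s %/ 2 ^ i * 2 ^ i)%N)
       + (f (s %/ 2 ^ i * 2 ^ i)%N - f (s %/ 2 ^ i.+1 * 2 ^ i.+1)%N) by ring.
  rewrite rmorphD /=; apply: le_trans (ler_normD _ _) _.
  apply: le_trans (lerD IH step) _.
  rewrite rS le_eqVlt; apply/orP; left; apply/eqP; field; lra.
move=> i s t iI /andP[st tM] dst.
have h1 := fl i s iI (leq_trans st tM); have h2 := fl i t iI tM.
have h3 : `|(f (t %/ 2 ^ i * 2 ^ i)%N - f (s %/ 2 ^ i * 2 ^ i)%N)%:~R|
    <= X * r ^+ (I - i).
  have p0 : (0 < 2 ^ i)%N by rewrite expn_gt0.
  have l1 : (s %/ 2 ^ i <= t %/ 2 ^ i)%N by exact: leq_div2r.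
  have l2 : (t %/ 2 ^ i <= (s %/ 2 ^ i).+1)%N.
    have : (t <= s + 2 ^ i)%N by rewrite -leq_subLR.
    by move/(leq_div2r (2 ^ i)); rewrite divnDr // divnn p0 addn1.
  have [->|ne] := eqVneq (t %/ 2 ^ i)%N (s %/ 2 ^ i)%N.
    by rewrite subrr normr0 mulr_ge0 ?exprn_ge0 //; lra.
  have tE : (t %/ 2 ^ i)%N = (s %/ 2 ^ i).+1.
    by apply/eqP; rewrite eqn_leq l2 ltn_neqAle eq_sym ne.
  by rewrite tE; apply: hf => //; rewrite -tE (leq_trans _ tM) // leq_divM.
have -> : f t - f s = (f t - f (t %/ 2 ^ i * 2 ^ i)%N)
    - (f s - f (s %/ 2 ^ i * 2 ^ i)%N)
    + (f (t %/ 2 ^ i * 2 ^ i)%N - f (s %/ 2 ^ i * 2 ^ i)%N) by ring.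
rewrite rmorphD rmorphB /=; apply: le_trans (ler_normD _ _) _.
apply: le_trans (lerD (ler_normB _ _) (lexx _)) _.
apply: le_trans (lerD (lerD h2 h1) h3) _.
set Y := X * _; have Y0 : 0 <= Y by rewrite mulr_ge0 ?exprn_ge0 //; lra.
have -> : X * (2 / (1 - r)) * r ^+ (I - i) = Y * (2 / (1 - r)).
  by rewrite /Y; ring.
have -> : Y * (r / (1 - r)) + Y * (r / (1 - r)) + Y
    = Y * ((1 + r) / (1 - r)) by field; lra.
by rewrite ler_wpM2l // ler_pM2r ?invr_gt0 //; lra.
Qed.

Definition fcount (T : Type) (W : seq T) (Q : T -> Prop) : R :=
  \sum_(w <- W) (`[< Q w >])%:R.

Lemma le_fcount (T : Type) (W : seq T) (Q Q' : T -> Prop) :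
  (forall w, Q w -> Q' w) -> fcount W Q <= fcount W Q'.
Proof.
move=> QQ; apply: ler_sum => w _; rewrite ler_nat.
by case: (asboolP (Q w)) => // /QQ /asboolP ->.
Qed.

Lemma fcount_size (T : Type) (W : seq T) Q : fcount W Q <= (size W)%:R.
Proof.
rewrite /fcount -sum1_size natr_sum; apply: ler_sum => w _.
by rewrite ler_nat leq_b1.
Qed.

(** Chernoff bound for both signs at once: when |g| > a, one of the two exponentials already exceeds
    exp (theta a). *)
Lemma fcount_gt_le (T : Type) (W : seq T) (g : T -> R) (C theta a : R) :
  0 <= theta ->
  \sum_(w <- W) expR (theta * g w) <= C * (size W)%:R ->
  \sum_(w <- W) expR (- theta * g w) <= C * (size W)%:R ->
  fcount W (fun w => a < `|g w|) <= 2 * C * expR (- (theta * a)) * (size W)%:R.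
Proof.
move=> t0 h1 h2.
have := lerD h1 h2; rewrite -big_split /= => h.
have e0 := expR_ge0 (- (theta * a)).
have := ler_wpM2l e0 h; rewrite mulr_sumr.
have -> : expR (- (theta * a)) * (C * (size W)%:R + C * (size W)%:R)
  = 2 * C * expR (- (theta * a)) * (size W)%:R by ring.
apply: le_trans; apply: ler_sum => w _.
case: (asboolP (a < `|g w|)) => [ha|_]; last first.
  by rewrite mulr_ge0 // addr_ge0 // expR_ge0.
rewrite mulrDr -!expRD /= .
have [g0|g0] := leP 0 (g w).
  rewrite -[leLHS]addr0 lerD ?expR_ge0 // -expR0 ler_expR.
  by move: ha; rewrite ger0_norm //; nra.
rewrite -[leLHS]add0r lerD ?expR_ge0 // -expR0 ler_expR.
by move: ha; rewrite ltr0_norm //; nra.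
Qed.

(** Raise z/q <= exp (z/q) to the power q. A polynomial tail of large degree is enough for chaining
    and sums as a geometric series. *)
Lemma expRN_le_pow (q : nat) (z : R) : (0 < q)%N -> 0 < z ->
  expR (- z) <= (q%:R / z) ^+ q.
Proof.
move=> q0 z0; have q0' : 0 < q%:R :> R by rewrite ltr0n.
rewrite expRN -[X in _ <= X]invrK lef_pV2 ?posrE ?expR_gt0 ?invr_gt0 ?exprn_gt0 ?divr_gt0 //.
rewrite -exprVn invf_div.
have {2}-> : z = (z / q%:R) * q%:R by field; lra.
rewrite [_ * q%:R]mulrC expRM_natl; apply: lerXn2r; rewrite ?nnegrE ?expR_ge0 ?divr_ge0 ?(ltW z0) //.
by have := expR_ge1Dx (z / q%:R); lra.
Qed.

Lemma exists_small_pow r (e : R) : 0 < r < 1 -> 0 < e ->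
  exists2 q, (0 < q)%N & r ^+ q <= e.
Proof.
move=> /andP[r0 r1] e0; have r1' : 0 < 1 - r by lra.
pose q := (Num.bound (e^-1 / (1 - r))).+1; exists q => //.
have hq : e^-1 / (1 - r) < q%:R.
  apply: lt_trans (archi_boundP _) _; last by rewrite ltr_nat.
  by rewrite divr_ge0 ?invr_ge0 // ltW.
have rE : r <= expR (- (1 - r)) by have := expR_ge1Dx (- (1 - r)); lra.
apply: (@le_trans _ _ (expR (- (1 - r)) ^+ q)).
  by apply: lerXn2r; rewrite ?nnegrE ?expR_ge0 // ltW.
rewrite -expRM_natl mulrN expRN -[e]invrK.
rewrite lef_pV2 ?posrE ?expR_gt0 ?invr_gt0 //.
apply: le_trans (le_trans _ (expR_ge1Dx _)); last exact: lexx.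
by move: hq; rewrite ltr_pdivrMr // => hq; nra.
Qed.

Lemma sum_half_le n : \sum_(i < n.+1) (2^-1 : R) ^+ (n - i) <= 2.
Proof.
rewrite (reindex_inj rev_ord_inj) /=.
suff -> : \sum_(i < n.+1) (2^-1 : R) ^+ (n - (n.+1 - i.+1))
    = 2 - (2^-1) ^+ n by rewrite gerBl exprn_ge0 // invr_ge0.
under eq_bigr => i _ do rewrite subSS subKn ?leq_ord //.
elim: n => [|n IH]; first by rewrite big_ord_recr big_ord0 /= expr0; lra.
by rewrite big_ord_recr /= IH exprS; field.
Qed.

(* The scale-i increments have sub-exponential tails at rate
   [(s r^(2(I-i)))^-1], so exceeding [v s r^(I-i)] costs [exp (- v r^(i-I))],
   which beats the number [2^(I-i)] of increments. *)
Lemma chaining r (C e : R) : 0 < r < 1 -> 0 < C -> 0 < e ->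
  exists2 v : R, 1 <= v & forall (T : Type) (W : seq T) (f : T -> nat -> int)
      (M I : nat) (s : R), (M <= 2 ^ I)%N -> 0 < s ->
    (forall i k, (i <= I)%N -> (k.+1 * 2 ^ i <= M)%N ->
      forall z : R, `|z| <= (s * r ^+ (2 * (I - i)))^-1 ->
      \sum_(w <- W) expR (z * (f w (k.+1 * 2 ^ i)%N - f w (k * 2 ^ i)%N)%:~R)
        <= C * (size W)%:R) ->
    fcount W (fun w => ~ holder (f w) M I (v * s * (2 / (1 - r))) r)
      <= e * (size W)%:R.
Proof.
move=> r01 C0 e0; have [r0 r1] := andP r01.
(* With r^q <= 1/4, the tail of one increment carries a factor 4^-(I-i); multiplied by the number
   2^(I-i) of increments it leaves 2^-(I-i), which is summable. *)
have [q q0 hq] := @exists_small_pow r (4^-1) r01 ltac:(by lra).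
have q0' : 0 < q%:R :> R by rewrite ltr0n.
(* The summand q gives q/v <= 1, so (q/v)^q <= q/v; the last summand brings this below e/(4C), where
   4 is the 2 of the two-sided tail times the 2 of [sum_half_le]. *)
pose v := 1 + q%:R + 4 * C * q%:R / e.
have c0 : 0 < 4 * C * q%:R / e by rewrite divr_gt0 // !mulr_gt0.
have v1 : 1 <= v by rewrite /v; lra.
have v0 : 0 < v by lra.
exists v => // T W f M I s MI s0 hW.
pose bad i k w := (k.+1 * 2 ^ i <= M)%N /\ v * s * r ^+ (I - i) <
  `|(f w (k.+1 * 2 ^ i)%N - f w (k * 2 ^ i)%N)%:~R|.
have qv : (q%:R / v) ^+ q <= e / (4 * C).
  have qv1 : q%:R / v <= 1 by rewrite ler_pdivrMr // mul1r /v; lra.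
  apply: (@le_trans _ _ (q%:R / v)).
    rewrite -[leRHS]expr1; apply: ler_wiXn2l => //.
    by rewrite divr_ge0 // ltW.
  rewrite ler_pdivrMr //.
  have -> : q%:R = e / (4 * C) * (4 * C * q%:R / e) by field; lra.
  rewrite ler_wpM2l //; last by rewrite /v; lra.
  by rewrite divr_ge0 ?ltW // mulr_gt0.
apply: (@le_trans _ _ (\sum_(i < I.+1) \sum_(k < 2 ^ (I - i)) fcount W (bad i k))).
  have -> : \sum_(i < I.+1) \sum_(k < 2 ^ (I - i)) fcount W (bad i k)
      = \sum_(w <- W) \sum_(i < I.+1) \sum_(k < 2 ^ (I - i)) (`[< bad i k w >])%:R.
    by rewrite [RHS]exchange_big /=; apply: eq_bigr => i _; rewrite exchange_big.
  apply: ler_sum => w _; case: asboolP => [nh|_]; last first.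
    by apply: sumr_ge0 => i _; apply: sumr_ge0.
  (* If every dyadic increment were small, [dyadic_holder] would give the Hoelder bound. *)
  have [i [k [iI hb]]] : exists i k, (i <= I)%N /\ bad i k w.
    apply: contrapT => nb; apply: nh; apply: dyadic_holder => //.
      by rewrite mulr_ge0 // ltW.
    move=> i k iI kM; rewrite leNgt; apply/negP => hb; apply: nb.
    by exists i, k.
  have iI' : (i < I.+1)%N by [].
  have kI : (k < 2 ^ (I - i))%N.
    rewrite -(ltn_pmul2r (_ : 0 < 2 ^ i)%N) ?expn_gt0 // -expnD subnK //.
    apply: leq_trans MI; apply: leq_trans hb.1.
    by rewrite mulSn addnC -addn1 leq_add2l expn_gt0.
  rewrite (bigD1 (Ordinal iI')) //= (bigD1 (Ordinal kI)) //= asboolT //.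
  rewrite -addrA lerDl addr_ge0 //; first exact: sumr_ge0.
  by apply: sumr_ge0 => ? _; apply: sumr_ge0.
have term (i : 'I_I.+1) (k : 'I_(2 ^ (I - i))) :
    fcount W (bad i k) <= 2 * C * ((q%:R / v) ^+ q * 4^-1 ^+ (I - i)) * (size W)%:R.
  have rp : 0 < r ^+ (I - i) by rewrite exprn_gt0.
  have [kM|kM] := boolP (k.+1 * 2 ^ i <= M)%N; last first.
    rewrite /fcount big1; last by move=> w _; rewrite asboolF // => -[] /(negP kM).
    by rewrite !mulr_ge0 ?exprn_ge0 ?divr_ge0 ?invr_ge0 // ltW.
  have iI : (i <= I)%N by rewrite -ltnS.
  pose th := (s * r ^+ (2 * (I - i)))^-1.
  have th0 : 0 <= th by rewrite invr_ge0 mulr_ge0 ?exprn_ge0 // ltW.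
  have h1 := hW i k iI kM th; have h2 := hW i k iI kM (- th).
  rewrite normrN ger0_norm // in h2; rewrite ger0_norm // in h1.
  pose g w := (f w (k.+1 * 2 ^ i)%N - f w (k * 2 ^ i)%N)%:~R : R.
  have le_bad w : bad i k w -> v * s * r ^+ (I - i) < `|g w| by case.
  apply: le_trans (le_fcount W le_bad) _.
  apply: le_trans (fcount_gt_le _ th0 (h1 (lexx _)) (h2 (lexx _))) _.
  rewrite ler_wpM2r // ler_wpM2l ?mulr_ge0 ?(ltW C0) //.
  have -> : th * (v * s * r ^+ (I - i)) = v / r ^+ (I - i).
    by rewrite /th mulnC exprM expr2; field; rewrite ?gt_eqF.
  apply: le_trans (expRN_le_pow q0 (divr_gt0 v0 rp)) _.
  rewrite invf_div mulrA [_ * r ^+ _ / v]mulrAC exprMn ler_wpM2l //.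
    by rewrite exprn_ge0 // divr_ge0 // ltW.
  by rewrite exprAC; apply: lerXn2r; rewrite ?nnegrE ?exprn_ge0 ?invr_ge0 // ltW.
apply: le_trans (ler_sum _ (fun i _ => ler_sum _ (fun k _ => term i k))) _.
set A := 2 * C * (q%:R / v) ^+ q * (size W)%:R.
have A0 : 0 <= A by rewrite !mulr_ge0 ?exprn_ge0 ?divr_ge0 // ltW.
apply: (@le_trans _ _ (\sum_(i < I.+1) A * 2^-1 ^+ (I - i))).
  apply: ler_sum => i _; rewrite sumr_const card_ord -[leLHS]mulr_natr natrX /A.
  rewrite le_eqVlt; apply/orP; left; apply/eqP.
  have -> : (2^-1 : R) ^+ (I - i) = 4^-1 ^+ (I - i) * 2 ^+ (I - i).
    by rewrite -exprMn; congr (_ ^+ _); field.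
  by ring.
rewrite -mulr_sumr; apply: le_trans (ler_wpM2l A0 (sum_half_le I)) _.
rewrite /A mulrAC ler_wpM2r // mulrAC.
have := ler_wpM2l (_ : 0 <= 2 * C * 2) qv.
have -> : 2 * C * 2 * (e / (4 * C)) = e by field; lra.
by apply; rewrite !mulr_ge0 // ltW.
Qed.

End Chaining.

(** * Scales and Hoelder rates of the successive levels *)

Section Scales.
Variable R : realType.

(* As 2^I will be of order n, scale j ^+ I is of order n^(1/2^j), and rate j
   stands for the Hoelder exponent 1/4^j at level j. *)
Definition scale (j : nat) : R := 2 `^ (2 ^+ j)^-1.
Definition rate (j : nat) : R := 2 `^ (- (4 ^+ j)^-1).

Lemma scaleS j : scale j.+1 ^+ 2 = scale j.
Proof.
rewrite /scale -powR_mulrn ?powR_ge0 // -powRrM.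
by congr (_ `^ _); rewrite exprS; field; rewrite expf_neq0.
Qed.

(** One square root comes from the fluctuations of the labels, the other is the loss [2 * (I - i)]
    versus [I - i] in [chaining]. *)
Lemma rateS j : rate j.+1 ^+ 4 = rate j.
Proof.
rewrite /rate -powR_mulrn ?powR_ge0 // -powRrM.
by congr (_ `^ _); rewrite exprS; field; rewrite expf_neq0.
Qed.

Lemma scale_ge1 j : 1 <= scale j.
Proof.
rewrite /scale -[leLHS](powRr0 (2 : R)) ler_powR ?invr_ge0 ?exprn_ge0 //; lra.
Qed.

Lemma scale_gt0 j : 0 < scale j.
Proof. exact: lt_le_trans ltr01 (scale_ge1 j). Qed.

Lemma rate_gt0 j : 0 < rate j.
Proof. by rewrite powR_gt0. Qed.

Lemma rate_lt1 j : rate j < 1.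
Proof.
rewrite /rate /powR pnatr_eq0 /= expR_lt1 mulNr oppr_lt0.
by rewrite mulr_gt0 ?invr_gt0 ?exprn_gt0 // ln_gt0 // ltr1n.
Qed.

Lemma rate_bounds j : 0 < rate j < 1.
Proof. by rewrite rate_gt0 rate_lt1. Qed.

Lemma scale_rate_ge1 j : 1 <= scale j * rate j.
Proof.
rewrite /scale /rate -powRD; last by apply/implyP => _; rewrite pnatr_eq0.
rewrite -[leLHS](powRr0 (2 : R)) ler_powR ?ler1n // subr_ge0.
rewrite lef_pV2 ?posrE ?exprn_gt0 //.
by apply: lerXn2r; rewrite ?nnegrE // ler_nat.
Qed.

(** The worst case is i = 0, where it says that the exponent 1/4^j does not exceed 1/2^j. It keeps
    the parameters of the exponential moments bounded and absorbs additive constants. *)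
Lemma scale_rate_pow_ge1 j I i : 1 <= scale j ^+ I * rate j ^+ (I - i).
Proof.
have h : (I - i <= I)%N by exact: leq_subr.
apply: (@le_trans _ _ (scale j ^+ (I - i) * rate j ^+ (I - i))).
  by rewrite -exprMn exprn_ege1 // scale_rate_ge1.
rewrite ler_wpM2r ?exprn_ge0 ?(ltW (rate_gt0 j)) //.
by rewrite ler_weXn2l ?scale_ge1.
Qed.

Lemma scale_expn j I : scale j ^+ I = (2 ^ I)%:R `^ (2 ^+ j)^-1.
Proof.
rewrite /scale -powR_mulrn ?powR_ge0 // -powRrM mulrC powRrM powR_mulrn //.
by rewrite natrX.
Qed.

(** Level 0 is the time axis: [scale 0 ^+ I * rate 0 ^+ (I - i)] is the block length 2^i, so bridges
    enter the recursion at level 1 like labels do later. *)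
Lemma scale0 : scale 0 = 2.
Proof. by rewrite /scale expr0 invr1 powRr1. Qed.

Lemma rate0 : rate 0 = 2^-1.
Proof. by rewrite /rate expr0 invr1 powRN powRr1. Qed.

End Scales.

Opaque scale rate.

(** * Trees, heights and contours *)

(** The induction hypothesis for the list of subtrees is a conjunction folded over that list, which
    can be consumed along a parallel induction on the list. *)
Lemma ptree_nested_ind (Q : ptree -> Prop) :
  (forall ts, foldr (fun t S => Q t /\ S) True ts -> Q (PNode ts)) ->
  forall t, Q t.
Proof.
move=> h; fix IH 1 => -[ts]; apply: h.
by elim: ts => //= t ts IHts; split.
Qed.

(** A named copy of the local fixpoint in [nodes], convertible to it; [i] is the rank of the next
    child. [traversal_from] plays the same role for [traversal]. *)
Fixpoint nodes_from (i : nat) (ts : seq ptree) : seq node :=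
  if ts is t :: ts' then map (cons i) (nodes t) ++ nodes_from i.+1 ts'
  else [::].

Fixpoint traversal_from (i : nat) (ts : seq ptree) : seq node :=
  if ts is t :: ts' then
    map (cons i) (traversal t) ++ [::] :: traversal_from i.+1 ts'
  else [::].

Lemma nodesE ts : nodes (PNode ts) = [::] :: nodes_from 0 ts.
Proof. by []. Qed.

Lemma traversalE ts : traversal (PNode ts) = [::] :: traversal_from 0 ts.
Proof. by []. Qed.

Lemma traversal_cons t : traversal t = [::] :: behead (traversal t).
Proof. by case: t. Qed.

Lemma nodes_cons t : nodes t = [::] :: behead (nodes t).
Proof. by case: t. Qed.

Definition tree_adjacent (u v : node) : bool :=
  [|| (u == take (size u) v) && (size v == (size u).+1)
    | (v == take (size v) u) && (size u == (size v).+1)].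

Lemma tree_adjacent_cons i u v : tree_adjacent (i :: u) (i :: v) = tree_adjacent u v.
Proof. by rewrite /tree_adjacent /= !eqSS !eqseq_cons eqxx. Qed.

(** Hence a walk that stays at depth at least q keeps the same ancestor at depth q. *)
Lemma tree_adjacent_take q u v : tree_adjacent u v ->
  (q <= size u)%N -> (q <= size v)%N -> take q u = take q v.
Proof.
move=> /orP[] /andP[/eqP e _] qu qv; first by rewrite e take_takel.
by rewrite [in RHS]e take_takel.
Qed.

Lemma tree_adjacent_size u v : tree_adjacent u v ->
  (size v == (size u).+1) || (size u == (size v).+1).
Proof. by case/orP => /andP[_ ->]; rewrite ?orbT. Qed.

Lemma traversal_path t :
  path tree_adjacent [::] (behead (traversal t)) /\
  last [::] (behead (traversal t)) = [::].
Proof.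
elim/ptree_nested_ind: t => ts; rewrite traversalE /=.
elim: ts 0%N => //= t ts IH i [[pt lt] /(IH i.+1) [pts lts]].
rewrite [traversal t]traversal_cons /= cat_path /= -/(map _ _) last_cat /= lts.
rewrite -/([:: i] : node) -[[:: i]]/(cons i [::]) path_map.
rewrite (eq_path (tree_adjacent_cons i)) pt.
by rewrite (last_map (cons i) _ [::]) lt pts /tree_adjacent.
Qed.

Lemma size_traversal t : size (traversal t) = (nb_edges t).*2.+1.
Proof.
suff : (size (traversal t)).+1 = (size (nodes t)).*2.
  rewrite /nb_edges nodes_cons /= doubleS => -[->]; done.
elim/ptree_nested_ind: t => ts; rewrite traversalE nodesE /= doubleS => h.
congr _.+2; elim: ts 0%N h => //= t ts IH i [ht /(IH i.+1) hts].
by rewrite !size_cat /= !size_map hts doubleD -ht addSnnS.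
Qed.

Lemma traversal_from_cases i ts u :
  (forall t, t \in ts -> {subset traversal t <= nodes t}) ->
  u \in traversal_from i ts -> u = [::] \/ u \in nodes_from i ts.
Proof.
elim: ts i => //= t ts IH i ht; rewrite mem_cat in_cons => /or3P[].
- case/mapP => v vt ->; right; rewrite mem_cat map_f //.
  by apply: ht => //; rewrite mem_head.
- by move/eqP; left.
- case/IH => [t' t'ts|->|h]; [|by left|by right; rewrite mem_cat h orbT].
  by apply: ht; rewrite in_cons t'ts orbT.
Qed.

Lemma foldr_andP (Q : ptree -> Prop) ts :
  foldr (fun t S => Q t /\ S) True ts -> forall t, t \in ts -> Q t.
Proof.
elim: ts => //= t ts IH [ht /IH hts] t'; rewrite in_cons.
by case/orP => [/eqP ->|/hts].
Qed.

Lemma traversal_sub_nodes t : {subset traversal t <= nodes t}.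
Proof.
elim/ptree_nested_ind: t => ts /foldr_andP h u; rewrite traversalE nodesE.
rewrite in_cons => /orP[/eqP ->|]; first exact: mem_head.
case/(traversal_from_cases h) => [->|hu]; first exact: mem_head.
by rewrite in_cons hu orbT.
Qed.

Lemma nodes_take t u k : u \in nodes t -> take k u \in nodes t.
Proof.
elim/ptree_nested_ind: t u k => ts /foldr_andP h u [|k].
  by rewrite take0 nodesE mem_head.
rewrite nodesE !in_cons => /orP[/eqP -> //|hu]; apply/orP; right.
elim: ts 0%N h hu => //= t ts IH i h.
rewrite !mem_cat => /orP[/mapP[v vt ->]|hu]; apply/orP; [left|right].
  by rewrite /= map_f //; apply: h => //; rewrite mem_head.
by apply: IH => // t' ht'; apply: h; rewrite in_cons ht' orbT.
Qed.

Fixpoint ups (x : nat) (s : seq nat) : seq nat :=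
  if s is y :: s' then (if (x < y)%N then y :: ups y s' else ups y s')
  else [::].

Lemma ups_cat x s1 s2 : ups x (s1 ++ s2) = ups x s1 ++ ups (last x s1) s2.
Proof. by elim: s1 x => //= y s1 IH x; rewrite IH; case: ifP. Qed.

Lemma ups_mapS x s : ups x.+1 (map S s) = map S (ups x s).
Proof. by elim: s x => //= y s IH x; rewrite ltnS IH; case: ifP. Qed.

(** An up-step of the contour is the first visit of a node, and first visits occur in
    lexicographical order. *)
Lemma heights_contour t : heights t = 0%N :: ups 0%N (behead (contour t)).
Proof.
rewrite /heights /contour behead_map.
elim/ptree_nested_ind: t => ts; rewrite traversalE nodesE /= => h; congr (_ :: _).
suff H i : map size (nodes_from i ts) = ups 0%N (map size (traversal_from i ts)) by [].
elim: ts i h => //= t ts IH i [ht /(IH i.+1) hts].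
rewrite !map_cat -!map_comp (eq_map (_ : size \o cons i =1 S \o size)) //.
rewrite map_comp ht hts [traversal t]traversal_cons /= ups_cat /= -/(map _ _).
rewrite (map_comp S size) ups_mapS /=; congr (_ :: _ ++ _).
Qed.

(** After its last up-step the sequence no longer increases. *)
Lemma last_ups_ge x s : (last x s <= last x (ups x s))%N.
Proof.
elim: s x => //= y s IH x; case: ltnP => //= yx.
by apply: leq_trans (IH y) _; case: (ups y s).
Qed.

Definition unit_step (a b : nat) : bool := (b == a.+1) || (a == b.+1).

(** Before its next up-step the path only descends, so that step lands at most one above the
    starting height. *)
Lemma head_ups_le x s : path unit_step x s ->
  (head x (ups x s) <= x.+1)%N.
Proof.
elim: s x => //= y s IH x /andP[/orP[/eqP ->|/eqP ->] /IH]; rewrite ?ltnSn //.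
rewrite ltnNge leqnSn /=; case: (ups y s) => //= z s'; move/leq_trans; apply.
exact: leqnSn.
Qed.

Lemma size_ups_le x s : (size (ups x s) <= size s)%N.
Proof. elim: s x => //= y s IH x; case: ifP => _; first exact: IH.
exact: leqW. Qed.

Lemma contour_cons t : contour t = 0%N :: behead (contour t).
Proof. by rewrite /contour traversal_cons. Qed.

Lemma contour_path t : path unit_step 0%N (behead (contour t)).
Proof.
rewrite /contour behead_map; have [+ _] := traversal_path t.
move=> h; rewrite (_ : 0%N = size ([::] : node)) // path_map.
apply: sub_path h => u v.
exact: tree_adjacent_size.
Qed.

Lemma size_contour t : size (contour t) = (nb_edges t).*2.+1.
Proof. by rewrite size_map size_traversal. Qed.

(* [e] is the lexicographical index of the last node discovered before the
   corner [r]; the next node discovered is a child of an ancestor of [c(r)]. *)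
Lemma contour_discovery t :
  let C := nth 0%N (contour t) in let H := nth 0%N (heights t) in
  exists e : nat -> nat,
  [/\ forall r, (r <= (nb_edges t).*2)%N -> (e r <= nb_edges t)%N,
      forall r, (r <= (nb_edges t).*2)%N -> (C r <= H (e r))%N,
      forall r, (r <= (nb_edges t).*2)%N -> (e r < nb_edges t)%N ->
        (H (e r).+1 <= (C r).+1)%N
    & forall r r', (r <= r' <= (nb_edges t).*2)%N ->
        (e r <= e r' <= e r + (r' - r))%N /\ (e r = e r' -> (C r' <= C r)%N)].
Proof.
move=> C H; pose s := behead (contour t).
have CE : contour t = 0%N :: s by rewrite contour_cons.
have HE : heights t = 0%N :: ups 0%N s by rewrite heights_contour.
have ss : size s = (nb_edges t).*2 by have := size_contour t; rewrite CE => -[].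
have su : size (ups 0%N s) = nb_edges t.
  by rewrite /nb_edges -(size_map size) -/(heights t) HE.
have Cr r : (r <= (nb_edges t).*2)%N -> C r = last 0%N (take r s).
  move=> rN; rewrite (last_nth 0) size_takel ?ss // /C CE.
  by case: r rN => //= r rN; rewrite nth_take.
(* [e r] counts the up-steps before time [r], that is, the non-root nodes discovered so far. *)
pose e r := size (ups 0%N (take r s)).
have ue r : ups 0%N s = ups 0%N (take r s) ++ ups (last 0%N (take r s)) (drop r s).
  by rewrite -ups_cat cat_take_drop.
have le_e r : (e r <= nb_edges t)%N by rewrite -su (ue r) size_cat leq_addr.
exists e; split => //.
- move=> r rN; rewrite Cr // /H HE; apply: leq_trans (last_ups_ge _ _) _.
  rewrite (ue r) (last_nth 0) -/(e r) -cat_cons nth_cat /= ltnS.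
  by rewrite -/(e r) leqnn.
- move=> r rN er; rewrite Cr // /H HE /= (ue r) nth_cat -/(e r) ltnn subnn.
  have := contour_path t; rewrite -/s -{1}(cat_take_drop r s) cat_path.
  case/andP=> _ /head_ups_le.
  case E : (ups _ (drop r s)) => [|z s'] //.
- move=> r r' /andP[rr' r'N].
  have tE : take r' s = take r s ++ take (r' - r) (drop r s).
    by rewrite take_drop subnK // -(take_takel s rr') cat_take_drop.
  have eE : e r' = (e r + size (ups (last 0%N (take r s)) (take (r' - r) (drop r s))))%N.
    by rewrite /e tE ups_cat size_cat.
  split.
    rewrite eE leq_addr leq_add2l; apply: leq_trans (size_ups_le _ _) _.
    by rewrite size_take_min geq_minl.
  rewrite eE -[LHS]addn0 => /eqP; rewrite eqn_add2l eq_sym size_eq0 => /eqP u0.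
  rewrite !Cr // ?(leq_trans rr') // tE last_cat.
  by apply: leq_trans (last_ups_ge _ _) _; rewrite u0.
Qed.

(** * Contour oscillations and label increments of a fixed tree *)

Section LabelledTrees.
Variable R : realType.
Implicit Types (t : ptree) (l : seq int).

Lemma min_argmin_lt l : (0 < size l)%N -> (min_argmin l < size l)%N.
Proof.
move=> l0; rewrite /min_argmin -has_find.
have [x xl xmin] : exists2 x : int, x \in l & all (fun y => x <= y) l.
  case: l l0 => // a l _; elim: l a => [|b l IH] a.
    by exists a; rewrite ?mem_head //= lexx.
  have [x xl xm] := IH b; have [xa|ax] := leP x a.
    by exists x; [rewrite in_cons xl orbT|apply/andP].
  exists a; rewrite ?mem_head //= lexx /=.
  by apply: sub_all xm => y; apply: le_trans; exact: ltW.
by apply/hasP; exists x.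
Qed.

(* One factor 2 comes from the cyclic shift in phi_LH (an interval of indices
   wraps around at most once), the other from passing from heights to contour. *)
Lemma contour_osc_le t l (m : nat) (w : R) :
  heights t = phi_LH l -> (0 < m)%N ->
  (size l).-1 = nb_edges t -> (0 < size l)%N ->
  nth 0 l 0 = 0 -> nth 0 l (size l).-1 = 0 ->
  (forall a b, (a <= b <= (size l).-1)%N -> (b - a <= m)%N ->
     `|(nth 0 l b - nth 0 l a)%:~R| <= w) ->
  forall s r, (s <= r <= (nb_edges t).*2)%N -> (r - s <= m)%N ->
    `|((nth 0%N (contour t) r)%:Z - (nth 0%N (contour t) s)%:Z)%:~R|
      <= 4 * w + 2.
Proof.
move=> hl m0 lN l0 first0 last0 osc s r /andP[sr rN] rs.
set N := nb_edges t in lN rN; rewrite lN in last0 osc.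
have w0 : 0 <= w.
  by have := osc 0%N 0%N; rewrite subrr normr0 leq0n /= => /(_ isT); apply.
have [N0|Npos] := posnP N.
  have -> : r = 0%N by apply/eqP; rewrite -leqn0 (leq_trans rN) // N0.
  have -> : s = 0%N by apply/eqP; rewrite -leqn0 (leq_trans sr) // (leq_trans rN) // N0.
  by rewrite subrr normr0; lra.
pose A := min_argmin l; have AN : (A <= N)%N.
  by have := min_argmin_lt l0; rewrite -/A -[size l]prednK // lN ltnS.
pose lc (k : nat) : int := nth 0 l (k %% N)%N.
(* The height formula of [phi_LH], used up to the index N+1, one past the last node; there it equals
   1 ([GN]), as if a further child of the root were to come. *)
pose G k := absz (1 + lc (A + k - 1)%N - nth 0 l A)%R.
have oscN a b : (a <= b <= N)%N -> (b - a <= m)%N -> `|((nth 0 l b)%:~R - (nth 0 l a)%:~R : R)| <= w.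
  by move=> h1 h2; rewrite -rmorphB; exact: osc.
have lcE k : (k <= N)%N -> lc k = nth 0 l k.
  rewrite leq_eqVlt => /orP[/eqP ->|kN]; last by rewrite /lc modn_small.
  by rewrite /lc modnn first0 last0.
have lcE2 k : (N <= k <= N.*2)%N -> lc k = nth 0 l (k - N)%N.
  move=> /andP[Nk kN]; rewrite -lcE ?leq_subLR ?addnn //.
  by rewrite /lc -{1}(subnK Nk) modnDr.
have oscG k k' : (0 < k)%N -> (k <= k' <= N.+1)%N -> (k' - k <= m)%N ->
    `|(G k')%:R - (G k)%:R : R| <= 2 * w.
  move=> k0 /andP[kk' k'N] d.
  have hlc : `|(lc (A + k' - 1)%N)%:~R - (lc (A + k - 1)%N)%:~R : R| <= 2 * w.
    have b1 : (A + k - 1 <= A + k' - 1)%N by rewrite leq_sub2r // leq_add2l.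
    have b2 : (A + k' - 1 <= N.*2)%N.
      by rewrite leq_subLR -addnn add1n -addnS leq_add.
    have b3 : (A + k' - 1 - (A + k - 1) <= m)%N by lia.
    move: (A + k - 1)%N (A + k' - 1)%N b1 b2 b3 => x y xy yN dxy.
    have [yN'|yN'] := leqP y N.
      rewrite !lcE ?(leq_trans xy) //.
      by apply: le_trans (oscN _ _ _ dxy) _; rewrite ?xy //; lra.
    rewrite (lcE2 y) ?yN ?andbT; last exact: ltnW.
    have [xN|xN] := leqP x N.
      rewrite lcE // -[_ - _](subrK ((nth 0 l N)%:~R : R)).
      have -> : (nth 0 l (y - N)%N)%:~R - (nth 0 l x)%:~R - (nth 0 l N)%:~R + (nth 0 l N)%:~R
        = ((nth 0 l (y - N)%N)%:~R - (nth 0 l 0)%:~R) + ((nth 0 l N)%:~R - (nth 0 l x)%:~R) :> R.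
        by rewrite first0 last0; ring.
      apply: le_trans (ler_normD _ _) _.
      have e1 := oscN 0%N (y - N)%N; have e2 := oscN x N.
      by rewrite mulr2n mulrDl !mul1r lerD ?e1 ?e2 //; lia.
    rewrite (lcE2 x); last by rewrite (ltnW xN) (leq_trans xy).
    by apply: le_trans (oscN _ _ _ _) _; rewrite ?leq_sub2r //; lia || lra.
  have absR (z : int) : (absz z)%:R = `|z%:~R| :> R by rewrite -intr_norm -abszE.
  rewrite !absR; apply: le_trans (ler_dist_dist _ _) _.
  move: hlc; rewrite -!rmorphB /=; set a := lc _; set b := lc _.
  by have -> : 1 + a - nth 0 l A - (1 + b - nth 0 l A) = a - b by ring.
have G1 : G 1%N = 1%N by rewrite /G addnK lcE // -addrA subrr addr0.
have GN : G N.+1 = 1%N.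
  by rewrite /G addnS subn1 /= /lc modnDr -/(lc A) lcE // -addrA subrr addr0.
have HG k : (0 < k <= N)%N -> nth 0%N (heights t) k = G k.
  case: k => // k /= kN; rewrite hl /phi_LH /= lN.
  rewrite (nth_map 0%N) ?size_iota // nth_iota // add1n.
have H0 : nth 0%N (heights t) 0 = 0%N by rewrite hl.
have [e [eN eC Ce ee]] := contour_discovery t.
set C := nth 0%N (contour t) in eC Ce ee *.
have [/andP[e1 e2] e3] := ee s r ltac:(by rewrite sr).
have sN := leq_trans sr rN.
(* If a node is discovered in between, C s is at least the height of node [e s + 1] minus 1, and C r
   is at most the height of node [e r]. *)
have up : (C r)%:R - (C s)%:R <= 2 * w + 1 :> R.
  have [es|es] := eqVneq (e s) (e r).
    by have := e3 es; rewrite -(ler_nat R); lra.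
  have {es}es : (e s < e r)%N by rewrite ltn_neqAle es e1.
  have q1 := Ce s sN (leq_trans es (eN r rN)); have q2 := eC r rN.
  have er := eN r rN.
  rewrite HG ?(leq_trans es) // in q1; rewrite HG ?(leq_trans _ es) // ?er in q2.
  have := @oscG (e s).+1 (e r); rewrite es (leq_trans er) //= => /(_ isT isT).
  have -> : (e r - (e s).+1 <= m)%N by lia.
  move=> /(_ isT) /ler_normlP[q3 q4].
  by move: q1 q2; rewrite -(ler_nat R) -[(C s).+1]addn1 natrD -(ler_nat R); lra.
(* Here the indices to compare are [e s] and [e r + 1], whose gap can reach m + 1. Cutting at
   [e s + 1] leaves two gaps of at most m, whence 4w. *)
have down : (C s)%:R - (C r)%:R <= 4 * w + 1 :> R.
  have q2 := eC s sN.
  (* Index 0 is the root, which [G] does not describe; then C s = 0. *)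
  have [es0|es0] := posnP (e s).
    move: q2; rewrite es0 H0 leqn0 => /eqP ->.
    by have : 0 <= (C r)%:R :> R by []; lra.
  have esN := eN s sN; have erN := eN r rN.
  have q1 : (G (e r).+1 <= (C r).+1)%N.
    have [er|er] := ltnP (e r) N; first by rewrite -HG ?er //; exact: Ce.
    have -> : e r = N by apply/eqP; rewrite eqn_leq er erN.
    by rewrite GN.
  rewrite HG ?es0 ?esN // in q2.
  have /ler_normlP[q3 q4] : `|(G (e s).+1)%:R - (G (e s))%:R : R| <= 2 * w.
    by apply: oscG => //; lia.
  have /ler_normlP[q5 q6] : `|(G (e r).+1)%:R - (G (e s).+1)%:R : R| <= 2 * w.
    by apply: oscG => //; lia.
  by move: q1 q2; rewrite -(ler_nat R) -[(C r).+1]addn1 natrD -(ler_nat R); lra.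
by rewrite rmorphB /=; apply/ler_normlP; split; rewrite ?opprB; lra.
Qed.

Lemma label_process_ext t (x y : nat -> int) :
  (forall k, (1 <= k <= nb_edges t)%N -> x k = y k) ->
  label_process t x = label_process t y.
Proof.
move=> xy; apply/eq_in_map => u /traversal_sub_nodes ut.
apply: eq_big_nat => i /andP[i0 iu]; apply: xy.
have := nodes_take i ut; rewrite /nb_edges -index_mem.
rewrite nodes_cons /=; case: eqP => [e|_]; last by rewrite ltnS.
by move: (congr1 size e); rewrite size_takel //=; case: i i0 {e iu}.
Qed.

(* The node of lexicographical index k >= 1 carries the letter k-1. *)
Definition steps_of_word (w : seq int) (k : nat) : int := nth 0 w k.-1.

(** The prefixes of [u] longer than [p] are distinct nodes of [t], so they carry distinct letters,
    [size u - p] in number. *)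
Lemma branch_expR_le t u (p q : nat) (z : R) :
  u \in nodes t -> (p <= size u)%N -> (nb_edges t <= q)%N -> `|z| <= 2^-1 ->
  \sum_(w <- words [:: -1; 0; 1] q)
     expR (z * (\sum_(p.+1 <= i < (size u).+1)
        steps_of_word w (index (take i u) (nodes t)))%:~R)
  <= expR (2 * z ^+ 2 * (size u - p)%:R) * 3 ^+ q.
Proof.
move=> ut pu tq hz.
pose ks := [seq (index (take i u) (nodes t)).-1 | i <- index_iota p.+1 (size u).+1].
have ipos i : (p.+1 <= i < (size u).+1)%N -> (0 < index (take i u) (nodes t))%N.
  move=> /andP[i0 iu]; rewrite nodes_cons /=; case: eqP => // e.
  by move: (congr1 size e); rewrite size_takel //=; case: i i0 {e iu}.
have := @sum_words_expR_le R [:: -1; 0; 1] q ks z; rewrite /= !size_map size_iota.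
rewrite subSS => h.
have : \sum_(w <- words [:: -1; 0; 1] q) expR (z * (\sum_(k <- ks) w`_k)%:~R)
    <= expR (2 * z ^+ 2 * (size u - p)%:R) * 3%:R ^+ q.
  apply: h => //.
  - by rewrite !big_cons big_nil.
  - rewrite map_inj_in_uniq ?iota_uniq // => i j.
    rewrite !mem_index_iota => hi hj ij.
    have {}ij : index (take i u) (nodes t) = index (take j u) (nodes t).
      by rewrite -(prednK (ipos i hi)) ij prednK // ipos.
    have := nth_index [::] (nodes_take i ut); rewrite ij nth_index ?nodes_take //.
    case/andP: hi hj => _ hi /andP[_ hj].
    by move/(congr1 size); rewrite !size_takel.
  - move=> k /mapP[i]; rewrite mem_index_iota => hi ->.
    apply: leq_trans tq; rewrite /nb_edges -ltnS prednK ?ipos //.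
    by rewrite prednK ?index_mem ?nodes_take // nodes_cons.
by rewrite /ks; under [X in X <= _ -> _]eq_bigr => w _ do rewrite big_map.
Qed.

(** On [s, r] the traversal stays at or above its minimal depth p, so both ends share their ancestor
    at depth p and the labels above it cancel. Each remaining branch has length at most [y]. The
    branches are decoupled by 2xx' <= x^2 + x'^2, which doubles the parameter: hence the range 1/4
    and the factor 8 = 2 * 2^2. *)
Lemma label_expR_le t (s r q : nat) (y : R) (z : R) :
  (s <= r <= (nb_edges t).*2)%N -> (nb_edges t <= q)%N ->
  (forall k, (s <= k <= r)%N ->
     (nth 0%N (contour t) s)%:R - (nth 0%N (contour t) k)%:R <= y :> R) ->
  (forall k, (s <= k <= r)%N ->
     (nth 0%N (contour t) r)%:R - (nth 0%N (contour t) k)%:R <= y :> R) ->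
  `|z| <= 4^-1 ->
  \sum_(w <- words [:: -1; 0; 1] q)
     expR (z * (nth 0 (label_process t (steps_of_word w)) r
                - nth 0 (label_process t (steps_of_word w)) s)%:~R)
  <= expR (8 * z ^+ 2 * y) * 3 ^+ q.
Proof.
move=> /andP[sr rN] tq ys yr hz.
pose c k := nth [::] (traversal t) k.
have st : size (traversal t) = (nb_edges t).*2.+1 by exact: size_traversal.
have Cc k : (k <= (nb_edges t).*2)%N -> nth 0%N (contour t) k = size (c k).
  by move=> kN; rewrite (nth_map [::]) // st ltnS.
(* [p] is the minimal depth between the two corners, attained at [k0]. *)
have [p [k0 k0in pE] pmin] : exists2 p, (exists2 k, (s <= k <= r)%N & size (c k) = p)
    & forall k, (s <= k <= r)%N -> (p <= size (c k))%N.
  have ex : exists p, has (fun k => size (c k) == p) (index_iota s r.+1).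
    exists (size (c s)); apply/hasP; exists s => //.
    by rewrite mem_index_iota leqnn ltnS.
  exists (ex_minn ex); case: ex_minnP => p /hasP[k hk /eqP kp] hmin.
    by exists k => //; move: hk; rewrite mem_index_iota ltnS.
  move=> k' hk'; apply: hmin; apply/hasP; exists k' => //.
  by rewrite mem_index_iota ltnS.
have common k : (s <= k <= r)%N -> take p (c k) = take p (c s).
  elim: k => [|k IH] /andP[sk kr].
    by move: sk; rewrite leqn0 => /eqP ->.
  move: sk; rewrite leq_eqVlt => /orP[/eqP -> //|sk].
  rewrite -IH ?(ltnW kr) ?andbT //; apply/esym/tree_adjacent_take.
  - have [+ _] := traversal_path t; move/(pathP [::]) => /(_ k).
    rewrite size_behead st /= (leq_trans kr rN) => /(_ isT).
    by rewrite -traversal_cons nth_behead.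
  - by apply: pmin; rewrite (ltnW kr) andbT.
  - by apply: pmin; rewrite kr ltnW.
have sin : (s <= s <= r)%N by rewrite leqnn.
have rin : (s <= r <= r)%N by rewrite leqnn andbT.
have sN := leq_trans sr rN.
have k0N : (k0 <= (nb_edges t).*2)%N by case/andP: k0in => _ /leq_trans; apply.
have ct k : (k <= (nb_edges t).*2)%N -> c k \in nodes t.
  by move=> kN; apply/traversal_sub_nodes/mem_nth; rewrite st ltnS.
pose B w k := \sum_(p.+1 <= i < (size (c k)).+1) steps_of_word w (index (take i (c k)) (nodes t)).
have labE w : nth 0 (label_process t (steps_of_word w)) r
     - nth 0 (label_process t (steps_of_word w)) s = B w r - B w s.
  rewrite !(nth_map [::]) ?st ?ltnS // -/(c r) -/(c s) /node_label.
  rewrite !(@big_cat_nat _ _ _ p.+1 1 (size _).+1) //= ?ltnS ?pmin // -/(B w r) -/(B w s).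
  rewrite opprD addrACA [X in X + _](_ : _ = 0) ?add0r //.
  apply/eqP; rewrite subr_eq0; apply/eqP; apply: eq_big_nat => i /andP[_ ip].
  by rewrite -(take_takel (c r) (ip : i <= p)%N) common // take_takel.
have BE k : (s <= k <= r)%N -> (size (c k))%:R - p%:R <= y -> forall z', `|z'| <= 2^-1 ->
    \sum_(w <- words [:: -1; 0; 1] q) expR (z' * (B w k)%:~R) <= expR (2 * z' ^+ 2 * y) * 3 ^+ q.
  move=> kin ky z' hz'; have kN : (k <= (nb_edges t).*2)%N by case/andP: kin => _ /leq_trans; apply.
  apply: le_trans (branch_expR_le (ct k kN) (pmin k kin) tq hz') _.
  rewrite ler_wpM2r ?exprn_ge0 // ler_expR natrB ?pmin // ler_wpM2l //.
  by rewrite mulr_ge0 // sqr_ge0.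
have z2 : `|2 * z| <= 2^-1 by rewrite normrM ger0_norm //; lra.
have z2' : `|- (2 * z)| <= 2^-1 by rewrite normrN.
have h1 : \sum_(w <- words [:: -1; 0; 1] q) expR (2 * z * (B w r)%:~R) <= expR (8 * z ^+ 2 * y) * 3 ^+ q.
  have -> : 8 * z ^+ 2 * y = 2 * (2 * z) ^+ 2 * y by ring.
  by apply: BE => //; rewrite -pE -!Cc //; exact: yr.
have h2 : \sum_(w <- words [:: -1; 0; 1] q) expR (- (2 * z) * (B w s)%:~R) <= expR (8 * z ^+ 2 * y) * 3 ^+ q.
  have -> : 8 * z ^+ 2 * y = 2 * (- (2 * z)) ^+ 2 * y by ring.
  by apply: BE => //; rewrite -pE -!Cc //; exact: ys.
set E := expR _ * _ in h1 h2 *.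
have -> : E = 2^-1 * (E + E) by field.
apply: le_trans (ler_wpM2l _ (lerD h1 h2)); last by rewrite invr_ge0.
rewrite -big_split mulr_sumr /=; apply: ler_sum => w _; rewrite labE rmorphB /=.
set a := (B w r)%:~R; set b := (B w s)%:~R.
have -> : 2 * z * a = z * a + z * a by ring.
have -> : - (2 * z) * b = - (z * b) + - (z * b) by ring.
have -> : z * (a - b) = z * a + - (z * b) by ring.
rewrite !expRD; set x := expR _; set x' := expR _.
by have := sqr_ge0 (x - x'); rewrite sqrrB !expr2; lra.
Qed.

End LabelledTrees.

(** * Bridges and Dyck paths *)

Lemma big_words_cat (R : nmodType) A m q (G : seq int -> R) :
  \sum_(w <- words A (m + q)) G w
  = \sum_(u <- words A m) \sum_(v <- words A q) G (u ++ v).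
Proof.
elim: m G => [|m IH] G; first by rewrite /= big_seq1.
rewrite addSn /= !big_allpairs_dep /=; apply: eq_bigr => a _.
by rewrite (IH (fun w => G (a :: w))).
Qed.

Definition pm1 : seq int := [:: -1; 1].

Lemma count_words_pm1 q k :
  count (fun w => count_mem 1 w == k) (words pm1 q) = 'C(q, k).
Proof.
elim: q k => [|q IH] k; first by case: k.
rewrite /= cats0 count_cat !count_map /=.
rewrite (eq_count (a2 := fun w => count_mem 1 w == k)) // IH.
case: k => [|k]; last first.
  by rewrite (eq_count (a2 := fun w => count_mem 1 w == k)) ?IH // binS.
by rewrite (eq_count (a2 := pred0)) // count_pred0 addn0 !bin0.
Qed.

Lemma sum_word_pm1 q w : w \in words pm1 q ->
  \sum_(a <- w) a = (count_mem 1 w).*2%:Z - q%:Z.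
Proof.
rewrite mem_words => /andP[/eqP <- {q}]; elim: w => [|a w IH] /=.
  by rewrite big_nil.
case/andP; rewrite !inE => aA /IH h; rewrite big_cons h.
by case/orP: aA => /eqP -> /=; lia.
Qed.

Lemma central_bin_rec p :
  (p.+1 * 'C(p.+1.*2, p.+1) = 2 * p.*2.+1 * 'C(p.*2, p))%N.
Proof.
have h1 := mul_bin_diag p.+1.*2 p; rewrite doubleS /= in h1.
have h2 := mul_bin_down p.*2.+1 p; rewrite /= in h2.
have e : (p.*2.+1 - p = p.+1)%N by rewrite -addnn -addnS addKn.
rewrite e in h2; rewrite doubleS.
apply/eqP; rewrite -(eqn_pmul2l (ltn0Sn p)); apply/eqP.
rewrite -h1 mulnCA -h2; move: 'C(_, _) => x; rewrite -mul2n; ring.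
Qed.

Lemma bin_le_central p k : ('C(p.*2, k) <= 'C(p.*2, p))%N.
Proof.
have up i : (i < p)%N -> ('C(p.*2, i) <= 'C(p.*2, i.+1))%N.
  move=> ip; rewrite -(leq_pmul2l (ltn0Sn i)) mul_bin_left leq_mul2r.
  by apply/orP; right; lia.
have low j : (j <= p)%N -> ('C(p.*2, j) <= 'C(p.*2, p))%N.
  move=> jp; rewrite -(subKn jp); elim: (p - j)%N (leq_subr j p) => [|d IH] dp.
    by rewrite subn0.
  apply: leq_trans (IH (ltnW dp)); have := up (p - d.+1)%N.
  by rewrite subnSK // => h; apply: h; lia.
have [/low //|pk] := leqP k p; have [k2|k2] := leqP k p.*2.
  by rewrite -bin_sub //; apply: low; lia.
by rewrite bin_small.
Qed.

(** An elementary form of Stirling's estimate, paired with [central_bin_lower]. The induction step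
    is (2p+1)(2p+3) <= (2p+2)^2. *)
Lemma central_bin_upper p : ('C(p.*2, p) ^ 2 * p.*2.+1 <= 16 ^ p)%N.
Proof.
elim: p => [|p IH] //; rewrite -(leq_pmul2l (_ : 0 < p.+1 ^ 2)%N) ?expn_gt0 //.
rewrite mulnA -expnMn central_bin_rec doubleS.
apply: (@leq_trans (4 * p.*2.+1 * p.*2.+3 * ('C(p.*2, p) ^ 2 * p.*2.+1))%N).
  by apply: eq_leq; ring.
apply: leq_trans (leq_mul (leqnn _) IH) _.
rewrite (expnS 16) mulnA leq_mul2r; apply/orP; right; rewrite -mul2n; nia.
Qed.

Lemma central_bin_lower p : (0 < p)%N -> (16 ^ p <= 4 * p * 'C(p.*2, p) ^ 2)%N.
Proof.
elim: p => // -[|p] IH _ //; have {}IH := IH isT; set n := p.+1 in IH *.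
rewrite -(leq_pmul2l (ltn0Sn n)).
apply: (@leq_trans (n.+1 * 16 * (4 * n * 'C(n.*2, n) ^ 2))%N).
  by rewrite expnS mulnA leq_mul2l IH orbT.
have -> : (n.+1 * (4 * n.+1 * 'C(n.+1.*2, n.+1) ^ 2)
   = 4 * (n.+1 * 'C(n.+1.*2, n.+1)) ^ 2)%N by ring.
rewrite central_bin_rec expnMn !mulnA leq_mul2r; apply/orP; right.
rewrite -mul2n; nia.
Qed.

(** A prefix of length m is completed to a bridge by [q] letters, k of them up-steps: its
    probability is at most 4 times its probability 2^-m for the simple walk. The proof compares
    squares, multiplied by n, to avoid square roots of integers. *)
Lemma bin_word_ratio n m q k : (0 < n)%N -> (m + q = n.*2.+1)%N -> (n <= q)%N ->
  (2 ^ m * 'C(q, k) <= 4 * 'C(n.*2.+1, n))%N.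
Proof.
move=> n0 mq nq; pose p := q./2.
have qE : q = (odd q + p.*2)%N by rewrite odd_double_half.
have h1 : ('C(q, k) <= 2 ^ odd q * 'C(p.*2, p))%N.
  rewrite {1}qE; case: (odd q); last by rewrite mul1n bin_le_central.
  have -> : (2 ^ true * 'C(p.*2, p) = 'C(p.*2, p) + 'C(p.*2, p))%N.
    by rewrite expn1 mul2n addnn.
  case: k => [|k]; first by rewrite bin0 addn_gt0 bin_gt0 -addnn leq_addr.
  by rewrite add1n binS leq_add // bin_le_central.
have h2 : ('C(n.*2, n) <= 'C(n.*2.+1, n))%N by case: n {mq nq} n0 => // n _; rewrite binS leq_addr.
rewrite -leq_sqr -(leq_pmul2r n0).
have h3 : ('C(q, k) ^ 2 * n <= 4 ^ q)%N.
  apply: (@leq_trans ((2 ^ odd q * 'C(p.*2, p)) ^ 2 * p.*2.+1)%N).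
    apply: leq_mul; first by rewrite leq_sqr.
    by apply: leq_trans nq _; rewrite {1}qE -add1n leq_add2r leq_b1.
  rewrite expnMn -mulnA; apply: (@leq_trans ((2 ^ odd q) ^ 2 * 16 ^ p)%N).
    by rewrite leq_mul2l central_bin_upper orbT.
  rewrite [X in (_ <= 4 ^ X)%N]qE expnD -mul2n expnM -expnM mulnC expnM -[(4 ^ 2)%N]/16%N.
  by rewrite mulnC; case: (odd q).
have h4 := central_bin_lower n0.
apply: (@leq_trans (4 ^ m * 4 ^ q)%N).
  have -> : (4 ^ m = (2 ^ m) ^ 2)%N by rewrite -expnM mulnC expnM.
  by rewrite expnMn -mulnA leq_mul2l h3 orbT.
rewrite -expnD mq expnS -mul2n expnM -[(4 ^ 2)%N]/16%N.
apply: (@leq_trans (4 * (4 * n * 'C(n.*2, n) ^ 2))%N); first by rewrite leq_mul2l h4 orbT.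
rewrite expnMn -[(4 ^ 2)%N]/16%N.
apply: (@leq_trans (16 * 'C(n.*2, n) ^ 2 * n)%N); first by apply: eq_leq; ring.
by apply: leq_mul => //; apply: leq_mul => //; rewrite leq_sqr mul2n.
Qed.

(** The length is odd and the sum is -1, the setting in which the cycle lemma singles out exactly
    one rotation. *)
Definition bridges (n : nat) : seq (seq int) :=
  [seq w <- words pm1 n.*2.+1 | \sum_(a <- w) a == -1].

Definition psum (w : seq int) (k : nat) : int := \sum_(a <- take k w) a.

Lemma mem_bridges n w : (w \in bridges n) =
  [&& size w == n.*2.+1, all (mem pm1) w & \sum_(a <- w) a == -1].
Proof. by rewrite mem_filter mem_words andbC -andbA. Qed.

Lemma uniq_bridges n : uniq (bridges n).
Proof. exact/filter_uniq/uniq_words. Qed.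

Lemma size_bridges n : size (bridges n) = 'C(n.*2.+1, n).
Proof.
rewrite size_filter -count_words_pm1; apply: eq_in_count => w hw.
by rewrite (sum_word_pm1 hw); apply/eqP/eqP; lia.
Qed.

(** Rotation invariance of the uniform bridge: every block has the law of a prefix of the same
    length. *)
Lemma rot_bridges n k : perm_eq [seq rot k w | w <- bridges n] (bridges n).
Proof.
have sub : {subset [seq rot k w | w <- bridges n] <= bridges n}.
  move=> _ /mapP[w hw ->]; move: hw; rewrite !mem_bridges size_rot.
  rewrite (perm_all (mem pm1) (s2 := w)) ?perm_rot //.
  suff -> : \sum_(a <- rot k w) a = \sum_(a <- w) a by [].
  by apply: perm_big; rewrite perm_rot.
have u : uniq [seq rot k w | w <- bridges n].
  by rewrite map_inj_uniq ?uniq_bridges //; exact: rot_inj.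
apply: uniq_perm => //; first exact: uniq_bridges.
have [] := uniq_min_size u sub; by rewrite ?size_map.
Qed.

Section Bridges.
Variable R : realType.

Lemma sum_bridges_prefix_le n m (F : seq int -> R) : (0 < n)%N -> (m <= n.+1)%N ->
  (forall w, 0 <= F w) ->
  \sum_(w <- bridges n) F (take m w)
  <= 4 * (\sum_(u <- words pm1 m) F u) / 2 ^+ m * (size (bridges n))%:R.
Proof.
move=> n0 mn F0; pose q := (n.*2.+1 - m)%N.
have mq : (m + q = n.*2.+1)%N by rewrite /q; lia.
have nq : (n <= q)%N by rewrite /q; lia.
rewrite big_filter -mq big_mkcond big_words_cat /=.
rewrite mulr_sumr !mulr_suml big_seq [leRHS]big_seq; apply: ler_sum => u hu.
have su : size u = m by move: hu; rewrite mem_words => /andP[/eqP].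
(* The sum of the completion is prescribed and equals 2k - q, which determines its number [k] of
   up-steps. *)
pose k := (absz (-1 - \sum_(a <- u) a + q%:Z)%R)./2.
apply: (@le_trans _ _ (\sum_(v <- words pm1 q) (if count_mem 1 v == k then F u else 0))).
  rewrite big_seq [leRHS]big_seq; apply: ler_sum => v hv.
  rewrite (take_size_cat v su) big_cat /= (sum_word_pm1 hv).
  case: eqP => [e|_]; last by case: ifP.
  suff -> : count_mem 1 v = k by rewrite eqxx.
  have h (x y z : int) : x + (y - z) - x + z = y by ring.
  by rewrite /k -e h /= doubleK.
rewrite -big_mkcond big_const_seq iter_addr_0 count_words_pm1 -[leLHS]mulr_natr.
have -> : 4 * F u / 2 ^+ m * (size (bridges n))%:R
    = F u * (4 * (size (bridges n))%:R / 2 ^+ m) by ring.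
rewrite ler_wpM2l // ler_pdivlMr ?exprn_gt0 // mulrC size_bridges.
by rewrite -natrX -!natrM ler_nat; exact: bin_word_ratio.
Qed.

Lemma psum_rot n w s m : w \in bridges n -> (s + m <= n.*2.+1)%N ->
  psum w (s + m) - psum w s = \sum_(a <- take m (rot s w)) a.
Proof.
rewrite mem_bridges => /and3P[/eqP sw _ _] sm.
rewrite /psum takeD big_cat /= addrAC subrr add0r /rot take_cat size_drop sw.
case: ltnP => // h; have -> : (m - (n.*2.+1 - s) = 0)%N by lia.
by rewrite take0 cats0 take_oversize // size_drop sw.
Qed.

Lemma bridge_short_block_expR_le n s m (z : R) : (0 < n)%N ->
  (m <= n.+1)%N -> (s + m <= n.*2.+1)%N -> `|z| <= 2^-1 ->
  \sum_(w <- bridges n) expR (z * (psum w (s + m) - psum w s)%:~R)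
  <= 4 * expR (2 * z ^+ 2 * m%:R) * (size (bridges n))%:R.
Proof.
move=> n0 mn sm hz.
pose F (w : seq int) := expR (z * (\sum_(a <- w) a)%:~R).
have -> : \sum_(w <- bridges n) expR (z * (psum w (s + m) - psum w s)%:~R)
    = \sum_(w <- bridges n) F (take m w).
  rewrite -[RHS](perm_big _ (rot_bridges n s)) big_map /= big_seq [RHS]big_seq.
  by apply: eq_bigr => w hw; rewrite (psum_rot hw).
apply: le_trans (sum_bridges_prefix_le n0 mn _) _; first by move=> w; exact: expR_ge0.
rewrite ler_wpM2r // -mulrA ler_wpM2l // ler_pdivrMr ?exprn_gt0 //.
have := @sum_words_expR_le R pm1 m (iota 0 m) z; rewrite size_iota => h.
apply: le_trans (h _ _ _ _ hz); rewrite ?iota_uniq //.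
- rewrite big_seq [leRHS]big_seq; apply: ler_sum => w.
  rewrite mem_words => /andP[/eqP sw _]; rewrite /F -sw.
  by rewrite (big_nth 0) big_mkord -(big_mkord xpredT (fun i => w`_i)) /index_iota subn0.
- by move=> a; rewrite !inE => /orP[] /eqP ->.
- by rewrite !big_cons big_nil.
- by move=> k; rewrite mem_iota.
Qed.

(** The density bound reaches only half of the bridge. A longer block is cut into two halves,
    recombined by 2xx' <= x^2 + x'^2 at twice the parameter. *)
Lemma bridge_block_expR_le n s m (z : R) : (0 < n)%N ->
  (s + m <= n.*2.+1)%N -> `|z| <= 4^-1 ->
  \sum_(w <- bridges n) expR (z * (psum w (s + m) - psum w s)%:~R)
  <= 4 * expR (8 * z ^+ 2 * m%:R) * (size (bridges n))%:R.
Proof.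
move=> n0 sm hz; pose m1 := m./2; pose m2 := (m - m1)%N.
have mE : (m = m1 + m2)%N by rewrite /m2 /m1; lia.
have hz2 : `|2 * z| <= 2^-1 by rewrite normrM ger0_norm //; lra.
have m1n : (m1 <= n.+1)%N by rewrite /m1; lia.
have m2n : (m2 <= n.+1)%N by rewrite /m2 /m1; lia.
have s1 : (s + m1 <= n.*2.+1)%N by lia.
have s2 : (s + m1 + m2 <= n.*2.+1)%N by lia.
have h1 := bridge_short_block_expR_le n0 m1n s1 hz2.
have h2 := bridge_short_block_expR_le n0 m2n s2 hz2.
set E := 4 * _ * _.
have le_E k : (k <= m)%N ->
    4 * expR (2 * (2 * z) ^+ 2 * k%:R) * (size (bridges n))%:R <= E.
  move=> km; rewrite ler_wpM2r // ler_wpM2l // ler_expR.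
  have -> : 2 * (2 * z) ^+ 2 * k%:R = 8 * z ^+ 2 * k%:R by ring.
  by apply: ler_wpM2l; [rewrite mulr_ge0 ?sqr_ge0|rewrite ler_nat].
have {}h1 := le_trans h1 (le_E m1 ltac:(lia)).
have {}h2 := le_trans h2 (le_E m2 ltac:(lia)).
have -> : E = 2^-1 * (E + E) by field.
apply: le_trans (ler_wpM2l _ (lerD h1 h2)); last by rewrite invr_ge0.
rewrite -big_split mulr_sumr /=; apply: ler_sum => w _.
rewrite {1}mE addnA.
have -> : psum w (s + m1 + m2) - psum w s =
  (psum w (s + m1) - psum w s) + (psum w (s + m1 + m2) - psum w (s + m1)) by ring.
rewrite rmorphD /=; set a := _%:~R; set b := _%:~R.
have -> : 2 * z * a = z * a + z * a by ring.
have -> : 2 * z * b = z * b + z * b by ring.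
rewrite mulrDr !expRD; set x := expR _; set x' := expR _.
by have := sqr_ge0 (x - x'); rewrite sqrrB !expr2; lra.
Qed.

Lemma bridge_holder_le (e : R) : 0 < e ->
  exists2 X : R, 1 <= X & forall n I, (0 < n)%N -> (n.*2.+1 <= 2 ^ I)%N ->
    fcount R (bridges n) (fun w =>
      ~ holder (psum w) n.*2.+1 I (X * scale R 1 ^+ I) (rate R 1))
    <= e * (size (bridges n))%:R.
Proof.
move=> e0; have r01 := rate_bounds R 1; have [r0 r1] := andP r01.
have c0 : 0 < 4 * expR 1 :> R by rewrite mulr_gt0 ?expR_gt0.
have [v v1 hv] := chaining r01 c0 e0.
pose X := v * 4 * (2 / (1 - rate R 1)).
have hr : 2 <= 2 / (1 - rate R 1) by rewrite ler_pdivlMr; lra.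
have X1 : 1 <= X by rewrite /X mulr_ege1 ?mulr_ege1 //; lra.
exists X => // n I n0 nI.
have -> : X * scale R 1 ^+ I = v * (4 * scale R 1 ^+ I) * (2 / (1 - rate R 1)).
  by rewrite /X; ring.
apply: hv => //; first by rewrite mulr_gt0 // exprn_gt0 // scale_gt0.
move=> i k iI kM z hz.
(* [Q] is the square root of the block length 2^i, so |z| <= 1/(4Q) keeps 8 z^2 2^i below 1; this is
   the [expR 1] in the constant given to [chaining]. *)
pose Q := scale R 1 ^+ I * rate R 1 ^+ (2 * (I - i)).
have QE : Q ^+ 2 = 2 ^+ i.
  rewrite /Q exprMn -!exprM [(I * 2)%N]mulnC [(2 * (I - i) * 2)%N]mulnAC.
  rewrite exprM [X in _ * X]exprM (scaleS R 0) (rateS R 0) scale0 rate0.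
  by rewrite -{1}(subnKC iI) exprD -mulrA -exprMn divff ?expr1n ?mulr1.
have Q0 : 0 < Q := mulr_gt0 (exprn_gt0 _ (scale_gt0 R 1)) (exprn_gt0 _ r0).
rewrite -mulrA -/Q in hz; clearbody Q.
have Q2 : 1 <= Q ^+ 2 by rewrite QE exprn_ege1 // ler1n.
have Q1 : 1 <= Q by nra.
have KQ : 0 < 4 * Q by rewrite mulr_gt0.
have hz4 : `|z| <= 4^-1.
  by apply: le_trans hz _; rewrite lef_pV2 ?posrE //; nra.
have zz : z ^+ 2 * (16 * Q ^+ 2) <= 1.
  rewrite -real_normK ?num_real //.
  have -> : 16 * Q ^+ 2 = (4 * Q) ^+ 2 by ring.
  rewrite -exprMn exprn_ile1 //; first by rewrite mulr_ge0 // ltW.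
  by rewrite -ler_pdivlMr // mul1r.
have kE : (k.+1 * 2 ^ i = k * 2 ^ i + 2 ^ i)%N by rewrite mulSn addnC.
rewrite kE in kM *.
apply: le_trans (bridge_block_expR_le n0 kM hz4) _.
rewrite ler_wpM2r // ler_wpM2l // ler_expR natrX -QE.
by have := sqr_ge0 z; lra.
Qed.

End Bridges.

(** * Dyck paths and the cycle lemma *)

Definition dycks (n : nat) : seq (seq nat) :=
  [seq map val (val c) |
    c <- enum [pred c : (n.*2.+1).-tuple 'I_n.+1 | is_dyck n (map val c)]].

Lemma size_dycks n : size (dycks n) = nb_dyck n.
Proof. by rewrite size_map -cardE. Qed.

Lemma uniq_dycks n : uniq (dycks n).
Proof.
rewrite map_inj_uniq ?enum_uniq // => x y h; apply/val_inj.
exact: (inj_map val_inj).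
Qed.

Lemma mem_dycks n c : (c \in dycks n) = is_dyck n c && all (fun x => (x <= n)%N) c.
Proof.
apply/mapP/andP => [[t]|[dc /allP cn]].
  rewrite mem_enum inE => dt ->; split=> //.
  by apply/allP => _ /mapP[i _ ->]; exact: ltn_ord i.
have sc : size c == n.*2.+1 by case/and4P: dc.
have st : size (map (@inord n) c) == n.*2.+1 by rewrite size_map.
have e : map val (map (@inord n) c) = c.
  rewrite -map_comp -[RHS]map_id; apply/eq_in_map => x /cn xn /=.
  by rewrite inordK.
by exists (Tuple st); rewrite ?mem_enum ?inE /= ?e.
Qed.

(** The appended down-step brings the sum to -1, so that only the full sum is negative. *)
Definition bridge_of_dyck (c : seq nat) : seq int :=
  rcons (mkseq (fun k => (nth 0%N c k.+1)%:Z - (nth 0%N c k)%:Z) (size c).-1) (-1).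

Definition good_bridge (n : nat) (w : seq int) : Prop :=
  w \in bridges n /\ forall k, (k <= n.*2)%N -> 0 <= psum w k.

Lemma psumS w k : (k < size w)%N -> psum w k.+1 = psum w k + w`_k.
Proof. by move=> kw; rewrite /psum (take_nth 0 kw) -cats1 big_cat big_seq1. Qed.

Lemma psum0 w : psum w 0 = 0.
Proof. by rewrite /psum take0 big_nil. Qed.

Lemma psum_size w : psum w (size w) = \sum_(a <- w) a.
Proof. by rewrite /psum take_size. Qed.

Lemma dyck_nth n c : is_dyck n c ->
  [/\ size c = n.*2.+1, nth 0%N c 0 = 0%N, nth 0%N c n.*2 = 0%N
    & forall k, (k < n.*2)%N -> unit_step (nth 0%N c k) (nth 0%N c k.+1)].
Proof.
case/and4P => /eqP sc /eqP h0 /eqP hl hs; split=> //.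
  by rewrite -[RHS]hl -nth_last sc.
move=> k kn; apply: (sortedP 0%N hs); by rewrite sc ltnS.
Qed.

Lemma psum_bridge_of_dyck n c k : is_dyck n c -> (k <= n.*2)%N ->
  psum (bridge_of_dyck c) k = (nth 0%N c k)%:Z.
Proof.
case/dyck_nth => sc c0 _ _; elim: k => [|k IH] kn.
  by rewrite psum0 c0.
rewrite psumS; last by rewrite size_rcons size_mkseq sc /= ltnW.
rewrite IH ?(ltnW kn) // nth_rcons size_mkseq sc /= kn nth_mkseq //.
by rewrite addrC subrK.
Qed.

Lemma good_bridge_of_dyck n c : is_dyck n c -> good_bridge n (bridge_of_dyck c).
Proof.
move=> dc; have [sc c0 c2 step] := dyck_nth dc.
split=> [|k kn]; last by rewrite (psum_bridge_of_dyck dc).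
have sz : size (bridge_of_dyck c) = n.*2.+1 by rewrite size_rcons size_mkseq sc.
rewrite mem_bridges sz eqxx /= -psum_size sz psumS ?sz //.
rewrite (psum_bridge_of_dyck dc) // c2 nth_rcons size_mkseq sc ltnn eqxx add0r andbT.
rewrite all_rcons /=; apply/allP => x /mapP[k]; rewrite mem_iota sc /= => kn ->.
by case/orP: (step k kn) => /eqP ->; rewrite !inE; lia.
Qed.

Lemma bridge_of_dyck_inj n c c' : is_dyck n c -> is_dyck n c' ->
  bridge_of_dyck c = bridge_of_dyck c' -> c = c'.
Proof.
move=> dc dc' e; have [sc _ _ _] := dyck_nth dc; have [sc' _ _ _] := dyck_nth dc'.
apply: (@eq_from_nth _ 0%N); first by rewrite sc sc'.
move=> k; rewrite sc ltnS => kn.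
by have := psum_bridge_of_dyck dc kn; rewrite e (psum_bridge_of_dyck dc' kn) => -[].
Qed.

Lemma pm1P (a : int) : a \in pm1 -> a = -1 \/ a = 1.
Proof. by rewrite !inE => /orP[] /eqP ->; [left|right]. Qed.

Lemma bridge_letter n w k : w \in bridges n -> (k < n.*2.+1)%N -> w`_k = -1 \/ w`_k = 1.
Proof.
rewrite mem_bridges => /and3P[/eqP sw /allP wA _] kn.
by apply/pm1P/wA/mem_nth; rewrite sw.
Qed.

Lemma bridge_psum_le n w j k : w \in bridges n -> (j <= k <= n.*2.+1)%N ->
  `|psum w k - psum w j| <= (k - j)%:Z.
Proof.
move=> wb /andP[jk kn]; have sw : size w = n.*2.+1 by move: wb; rewrite mem_bridges => /and3P[/eqP].
elim: k jk kn => [|k IH]; first by rewrite leqn0 => /eqP -> _; rewrite subrr.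
rewrite leq_eqVlt => /orP[/eqP -> _|jk kn]; first by rewrite subrr normr0.
have := IH jk (ltnW kn); rewrite psumS ?sw // subSn //.
by case: (bridge_letter wb kn) => ->; lia.
Qed.

Lemma good_bridge_dyck n w : good_bridge n w ->
  exists2 c, c \in dycks n & bridge_of_dyck c = w.
Proof.
move=> [wb pos]; have sw : size w = n.*2.+1 by move: wb; rewrite mem_bridges => /and3P[/eqP].
have last1 : psum w n.*2.+1 = -1.
  by rewrite -sw psum_size; move: wb; rewrite mem_bridges => /and3P[_ _ /eqP].
(* The partial sum is nonnegative at 2n and equals -1 one step later. *)
have [p2 l2] : psum w n.*2 = 0 /\ w`_(n.*2) = -1.
  have := last1; rewrite psumS ?sw // => h; have p0 := pos n.*2 (leqnn _).
  by case: (bridge_letter wb (ltnSn n.*2)) => e; move: h; rewrite e; lia.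
pose c := mkseq (fun k => absz (psum w k)) n.*2.+1.
have cE k : (k <= n.*2)%N -> (nth 0%N c k)%:Z = psum w k.
  by move=> kn; rewrite nth_mkseq // gez0_abs // pos.
have cs : sorted unit_step c.
  apply/(sortedP 0%N) => k; rewrite size_mkseq ltnS => kn.
  have e1 := cE k (ltnW kn); have e2 := cE k.+1 kn.
  rewrite psumS ?sw ?leqW // in e2; rewrite /unit_step.
  by case: (bridge_letter wb (leqW kn)) => e; rewrite e -e1 in e2; lia.
have dc : is_dyck n c.
  apply/and4P; split=> //; first by rewrite size_mkseq.
    by rewrite /c /= psum0.
  by rewrite -nth_last size_mkseq -eqz_nat cE //= p2.
have sc : size c = n.*2.+1 by rewrite size_mkseq.
clearbody c; exists c.
  rewrite mem_dycks dc; apply/allP => x /(nthP 0%N)[k]; rewrite sc ltnS => kn <-.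
  (* The height at k is at most k and at most 2n - k, hence at most n, as [dycks] demands. *)
  have := @bridge_psum_le n w 0 k wb; rewrite psum0 /= leqW // => /(_ isT).
  have := @bridge_psum_le n w k n.*2 wb; rewrite p2 kn /= leqnSn => /(_ isT).
  by rewrite -cE //; lia.
have sb : size (bridge_of_dyck c) = n.*2.+1 by rewrite size_rcons size_mkseq sc.
apply: (@eq_from_nth _ 0); first by rewrite sb sw.
move=> k; rewrite sb ltnS /bridge_of_dyck nth_rcons size_mkseq sc [_.+1.-1]/=.
rewrite leq_eqVlt => /orP[/eqP ->|kn]; first by rewrite ltnn eqxx l2.
rewrite kn nth_mkseq // !cE ?(ltnW kn) //.
by rewrite psumS ?sw ?leqW // addrAC subrr add0r.
Qed.

Lemma psum_rotE n w b k : w \in bridges n -> (b <= n.*2.+1)%N -> (k <= n.*2.+1)%N ->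
  psum (rot b w) k =
    if (k <= n.*2.+1 - b)%N then psum w (b + k) - psum w b
    else psum w n.*2.+1 - psum w b + psum w (k - (n.*2.+1 - b)).
Proof.
move=> wb bn kn; have sw : size w = n.*2.+1 by move: wb; rewrite mem_bridges => /and3P[/eqP].
case: leqP => h; first by rewrite (psum_rot wb) // -leq_subRL.
rewrite /psum /rot take_cat size_drop sw ltnNge (ltnW h) /= big_cat /=.
rewrite take_takel; last by rewrite leq_subLR; lia.
rewrite [take n.*2.+1 w]take_oversize ?sw //.
have -> : \sum_(a <- w) a = \sum_(a <- take b w) a + \sum_(a <- drop b w) a.
  by rewrite -big_cat cat_take_drop.
by rewrite [X in X - _]addrC addrK.
Qed.

Lemma rot_good_exists n w : w \in bridges n ->
  exists2 a, (a < n.*2.+1)%N & exists2 g, good_bridge n g & w = rot a g.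
Proof.
move=> wb; have sw : size w = n.*2.+1 by move: wb; rewrite mem_bridges => /and3P[/eqP].
have last1 : psum w n.*2.+1 = -1.
  by rewrite -sw psum_size; move: wb; rewrite mem_bridges => /and3P[_ _ /eqP].
(* Rotating at the first minimum makes all proper partial sums nonnegative. *)
have [b [bn bmin bfirst]] : exists b, [/\ (b <= n.*2.+1)%N,
    forall k, (k <= n.*2.+1)%N -> psum w b <= psum w k
  & forall k, (k < b)%N -> psum w b < psum w k].
  elim: n.*2.+1 => [|m [b [bm h1 h2]]].
    by exists 0%N; split=> // k; rewrite leqn0 => /eqP ->.
  have [lt|ge] := ltP (psum w m.+1) (psum w b).
    exists m.+1; split=> // k.
      rewrite leq_eqVlt => /orP[/eqP -> //|km]; rewrite ltnS in km.
      exact/ltW/(lt_le_trans lt)/h1.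
    by rewrite ltnS => km; apply: (lt_le_trans lt); exact: h1.
  exists b; split=> //; first exact: leqW.
  by move=> k; rewrite leq_eqVlt => /orP[/eqP -> //|km]; apply: h1.
have b0 : (0 < b)%N.
  case: b bmin {bn bfirst} => // /(_ n.*2.+1 (leqnn _)); rewrite psum0 last1; lia.
exists (n.*2.+1 - b)%N; first by lia.
exists (rot b w); last first.
  by rewrite -{1}sw -(size_rot b) -/(rotr b _) rotK.
split.
  by have /perm_mem <- := rot_bridges n b; rewrite map_f.
move=> k kn; rewrite (psum_rotE wb bn) ?leqW //.
case: leqP => h; first by rewrite subr_ge0 bmin //; lia.
have := bfirst (k - (n.*2.+1 - b))%N ltac:(lia).
by rewrite last1; lia.
Qed.

(** Uniqueness in the cycle lemma: if g is g' rotated by d > 0, then the partial sum of g at 2n+1-d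
    is -1 minus that of g' at d, hence negative before the last step. *)
Lemma rot_good_inj n a a' g g' : good_bridge n g -> good_bridge n g' ->
  (a < n.*2.+1)%N -> (a' < n.*2.+1)%N -> rot a g = rot a' g' -> a = a' /\ g = g'.
Proof.
wlog aa : a a' g g' / (a <= a')%N => [hw|] hg hg' an an' e.
  have [/hw|/ltnW /hw] := leqP a a'; first exact.
  by move=> h; have [] := h g' g hg' hg an' an (esym e) => -> ->.
have [gb pos] := hg; have [gb' pos'] := hg'.
have sg' : size g' = n.*2.+1 by move: gb'; rewrite mem_bridges => /and3P[/eqP].
have last1 : psum g' n.*2.+1 = -1.
  by rewrite -sg' psum_size; move: gb'; rewrite mem_bridges => /and3P[_ _ /eqP].
have gE : g = rot (a' - a) g'.
  apply: (@rot_inj a); rewrite e -rotD ?subnKC // sg'.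
  exact: ltnW.
have [d0|dpos] := posnP (a' - a)%N.
  have aE : a = a' by lia.
  by split=> //; rewrite gE d0 rot0.
have := pos (n.*2.+1 - (a' - a))%N ltac:(lia).
rewrite gE (psum_rotE gb') ?leqnn; [|lia|lia].
have -> : (a' - a + (n.*2.+1 - (a' - a)) = n.*2.+1)%N by lia.
have := pos' (a' - a)%N ltac:(lia).
by rewrite last1; lia.
Qed.

Definition rotated_dycks (n : nat) : seq (seq int) :=
  [seq rot a (bridge_of_dyck c) | c <- dycks n, a <- iota 0 n.*2.+1].

Lemma perm_rotated_dycks n : perm_eq (rotated_dycks n) (bridges n).
Proof.
apply: uniq_perm; last 1 first.
- move=> w; apply/allpairsP/idP => [[[c a] /= [cd _ ->]]|wb].
    move: cd; rewrite mem_dycks => /andP[dc _].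
    have [gb _] := good_bridge_of_dyck dc.
    by have /perm_mem <- := rot_bridges n a; rewrite map_f.
  have [a an [g gg ->]] := rot_good_exists wb.
  have [c cd gE] := good_bridge_dyck gg.
  by exists (c, a); split; rewrite ?mem_iota ?gE.
- apply: allpairs_uniq; rewrite ?uniq_dycks ?iota_uniq // => -[c a] [c' a'].
  move=> /allpairsP[p [pd pi [-> ->]]] /allpairsP[p' [pd' pi' [-> ->]]].
  move: pd pd' pi pi'; rewrite !mem_dycks !mem_iota => /andP[dp _] /andP[dp' _] pi pi'.
  case/(rot_good_inj (good_bridge_of_dyck dp) (good_bridge_of_dyck dp') pi pi') => ->.
  by move/(bridge_of_dyck_inj dp dp') => ->.
- exact: uniq_bridges.
Qed.

Section DyckHolder.
Variable R : realType.

(** A window of the rotated word is a window of [w], or a final window of [w] followed by an initial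
    one, each no longer than the whole. *)
Lemma holder_rot n I (X r : R) w b : w \in bridges n -> (b <= n.*2.+1)%N ->
  0 <= X -> 0 <= r -> holder (psum w) n.*2.+1 I X r ->
  holder (psum (rot b w)) n.*2.+1 I (2 * X) r.
Proof.
move=> wb bn X0 r0 h i s t iI /andP[st tn] d.
have Xr : 0 <= X * r ^+ (I - i) by rewrite mulr_ge0 ?exprn_ge0.
rewrite !(psum_rotE wb bn) ?(leq_trans st tn) //.
have hh j k : (j <= k <= n.*2.+1)%N -> (k - j <= 2 ^ i)%N ->
  `|(psum w k - psum w j)%:~R| <= X * r ^+ (I - i) by exact: h.
rewrite -mulrA mulr2n mulrDl mul1r.
case: (leqP s) => h1; case: (leqP t) => h2.
- have -> : psum w (b + t) - psum w b - (psum w (b + s) - psum w b)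
    = psum w (b + t) - psum w (b + s) by ring.
  apply: le_trans (hh _ _ _ _) _; [lia|lia|lra].
- have -> : psum w n.*2.+1 - psum w b + psum w (t - (n.*2.+1 - b)) - (psum w (b + s) - psum w b)
    = (psum w n.*2.+1 - psum w (b + s)) + (psum w (t - (n.*2.+1 - b)) - psum w 0).
    by rewrite psum0; ring.
  rewrite rmorphD /=; apply: le_trans (ler_normD _ _) _.
  by apply: lerD; apply: hh; lia.
- by lia.
- have -> : psum w n.*2.+1 - psum w b + psum w (t - (n.*2.+1 - b))
     - (psum w n.*2.+1 - psum w b + psum w (s - (n.*2.+1 - b)))
    = psum w (t - (n.*2.+1 - b)) - psum w (s - (n.*2.+1 - b)) by ring.
  apply: le_trans (hh _ _ _ _) _; [lia|lia|lra].
Qed.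

(* Each Dyck path corresponds to the 2n+1 rotations of its steps followed by
   -1, and the Hoelder property is invariant under rotation up to a factor 2. *)
Lemma dyck_holder_le (e : R) : 0 < e ->
  exists2 X : R, 1 <= X & forall n I, (0 < n)%N -> (n.*2.+1 <= 2 ^ I)%N ->
    fcount R (dycks n) (fun c =>
      ~ holder (fun k => (nth 0%N c k)%:Z) n.*2 I (X * scale R 1 ^+ I) (rate R 1))
    <= e * (size (dycks n))%:R.
Proof.
move=> e0; have [X X1 hX] := bridge_holder_le e0.
exists (2 * X) => [|n I n0 nI]; first by lra.
have M0 : 0 < (n.*2.+1)%:R :> R by rewrite ltr0n.
rewrite -(ler_pM2r M0) -[leRHS]mulrA -natrM.
have sB : (size (dycks n) * n.*2.+1)%N = size (bridges n).
  by rewrite -(perm_size (perm_rotated_dycks n)) size_allpairs size_iota.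
rewrite sB; apply: le_trans (hX n I n0 nI).
rewrite {2}/fcount -(perm_big _ (perm_rotated_dycks n)) big_allpairs_dep /= mulr_suml.
rewrite big_seq [leRHS]big_seq; apply: ler_sum => c; rewrite mem_dycks => /andP[dc _].
have -> : (`[< ~ holder (fun k => (nth 0%N c k)%:Z) n.*2 I
     (2 * X * scale R 1 ^+ I) (rate R 1) >])%:R * (n.*2.+1)%:R
  = \sum_(a <- iota 0 n.*2.+1) (`[< ~ holder (fun k => (nth 0%N c k)%:Z) n.*2 I
     (2 * X * scale R 1 ^+ I) (rate R 1) >])%:R :> R.
  by rewrite big_const_seq iter_addr_0 count_predT size_iota mulr_natr.
rewrite big_seq [leRHS]big_seq; apply: ler_sum => a; rewrite mem_iota add0n /= => an.
rewrite ler_nat; case: asboolP => // nh; rewrite asboolT // => hw; apply: nh.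
have gg := good_bridge_of_dyck dc; have [gb _] := gg.
have sg : size (bridge_of_dyck c) = n.*2.+1 by move: gb; rewrite mem_bridges => /and3P[/eqP].
have rb : rot a (bridge_of_dyck c) \in bridges n.
  by have /perm_mem <- := rot_bridges n a; rewrite map_f.
have := holder_rot (b := n.*2.+1 - a) rb (leq_subr _ _) _ _ hw.
have -> : rot (n.*2.+1 - a) (rot a (bridge_of_dyck c)) = bridge_of_dyck c.
  by rewrite -{1}sg -(size_rot a) -/(rotr a _) rotK.
rewrite mulrA => h.
move=> i s t iI /andP[st tn] d; rewrite -!(psum_bridge_of_dyck dc) ?(leq_trans st) //.
apply: h => //; last by rewrite st leqW.
- by rewrite mulr_ge0 ?exprn_ge0 ?(ltW (scale_gt0 _ _)) //; lra.
- exact/ltW/rate_gt0.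
Qed.

End DyckHolder.

(* The tree T^(j+1) built from C^(1) = c and the label steps x 1, ..., x j. *)
Definition level_tree (c : seq nat) (x : nat -> nat -> int) (j : nat) : ptree :=
  tree_of_contour
    (iteri j (fun i c' => phi_HC (phi_LH (label_process (tree_of_contour c') (x i.+1)))) c).

Lemma tree_of_contourP c :
  contour (tree_of_contour c) = c \/ tree_of_contour c = leaf.
Proof.
rewrite /tree_of_contour; case: xgetP => [t -> ht|_]; by [left|right].
Qed.

Lemma tree_of_heightsP h :
  heights (tree_of_heights h) = h \/ tree_of_heights h = leaf.
Proof.
rewrite /tree_of_heights; case: xgetP => [t -> ht|_]; by [left|right].
Qed.

Lemma contour_tree_of_contour t : contour (tree_of_contour (contour t)) = contour t.
Proof.
rewrite /tree_of_contour; case: xgetP => [t' -> //|/(_ t)/=]; by move/(_ erefl).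
Qed.

Lemma contour_nb_edges t t' : contour t = contour t' -> nb_edges t = nb_edges t'.
Proof.
by move/(congr1 size); rewrite !size_contour => -[] /(congr1 half); rewrite !doubleK.
Qed.

Lemma size_label_process t x : size (label_process t x) = (nb_edges t).*2.+1.
Proof. by rewrite size_map size_traversal. Qed.

Lemma label_process_first t x : nth 0 (label_process t x) 0 = 0.
Proof. by rewrite /label_process traversal_cons /= /node_label big_geq. Qed.

Lemma label_process_last t x : nth 0 (label_process t x) (nb_edges t).*2 = 0.
Proof.
rewrite (nth_map [::]) ?size_traversal //.
have [_] := traversal_path t; rewrite (last_nth [::]) size_behead size_traversal /=.
by rewrite -traversal_cons => ->; rewrite /node_label big_geq.
Qed.

(** * From one level to the next *)

Section OneLevel.
Variable R : realType.

Definition contour_holder (t : ptree) (I : nat) (X r : R) : Prop :=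
  holder (fun k => (nth 0%N (contour t) k)%:Z) (nb_edges t).*2 I X r.

Lemma contour_holder_eq t t' I X r : contour t = contour t' ->
  contour_holder t I X r -> contour_holder t' I X r.
Proof. by move=> h; rewrite /contour_holder h (contour_nb_edges h). Qed.

Lemma contour_holder_leaf I X r : 0 <= X -> 0 <= r -> contour_holder leaf I X r.
Proof.
move=> X0 r0 i s t _ _ _.
have e k : nth 0%N (contour leaf) k = 0%N by case: k => // -[].
by rewrite !e subrr normr0 mulr_ge0 ?exprn_ge0.
Qed.

(** The tree is fixed and only its labels are random: this is the estimate conditional on the tree,
    with an [X] that depends on it only through [K]. *)
Lemma label_holder_le j (K e : R) : 1 <= K -> 0 < e ->
  exists2 X : R, 1 <= X & forall t q I,
    (nb_edges t <= q)%N -> ((nb_edges t).*2 <= 2 ^ I)%N ->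
    contour_holder t I (K * scale R j ^+ I) (rate R j) ->
    fcount R (words [:: -1; 0; 1] q) (fun w =>
      ~ holder (fun k => nth 0 (label_process t (steps_of_word w)) k)
          (nb_edges t).*2 I (X * scale R j.+1 ^+ I) (rate R j.+1))
    <= e * (size (words [:: -1; 0; 1] q))%:R.
Proof.
move=> K1 e0; have r01 := rate_bounds R j.+1; have [r0 r1] := andP r01.
have [v v1 hv] := chaining r01 (expR_gt0 1) e0.
pose X := v * (4 * K) * (2 / (1 - rate R j.+1)).
have hr : 2 <= 2 / (1 - rate R j.+1) by rewrite ler_pdivlMr; lra.
have X1 : 1 <= X.
  by rewrite /X mulr_ege1 ?mulr_ege1 //; lra.
exists X => // t q I tq tI ct.
have s1 : 1 <= scale R j.+1 ^+ I by rewrite exprn_ege1 ?scale_ge1.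
have -> : X * scale R j.+1 ^+ I = v * (4 * K * scale R j.+1 ^+ I) * (2 / (1 - rate R j.+1)).
  by rewrite /X; ring.
apply: hv => //; first by rewrite mulr_gt0 ?mulr_gt0 //; lra.
move=> i k iI kM z hz.
(* K Q^2 is the contour bound at scale i, hence bounds the branches in [label_expR_le]; |z| <=
   1/(4KQ) then keeps 8 z^2 K Q^2 below 1. *)
pose Q := scale R j.+1 ^+ I * rate R j.+1 ^+ (2 * (I - i)).
have QE : Q ^+ 2 = scale R j ^+ I * rate R j ^+ (I - i).
  rewrite /Q exprMn -[in RHS](scaleS R j) -[in RHS](rateS R j) -!exprM.
  by rewrite [(I * 2)%N]mulnC [(2 * (I - i) * 2)%N]mulnAC.
have Q2 : 1 <= Q ^+ 2 by rewrite QE scale_rate_pow_ge1.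
have Q0 : 0 < Q := mulr_gt0 (exprn_gt0 _ (scale_gt0 R j.+1)) (exprn_gt0 _ r0).
have Q1 : 1 <= Q by nra.
rewrite -mulrA -/Q in hz; clearbody Q.
have KQ : 0 < 4 * K * Q by rewrite !mulr_gt0 //; lra.
have hz4 : `|z| <= 4^-1.
  by apply: le_trans hz _; rewrite lef_pV2 ?posrE //; nra.
have zz : z ^+ 2 * (16 * K ^+ 2 * Q ^+ 2) <= 1.
  rewrite -real_normK ?num_real //.
  have -> : 16 * K ^+ 2 * Q ^+ 2 = (4 * K * Q) ^+ 2 by ring.
  rewrite -exprMn exprn_ile1 //; first by rewrite mulr_ge0 // ltW.
  by rewrite -ler_pdivlMr // mul1r.
have le_kk : (k * 2 ^ i <= k.+1 * 2 ^ i)%N by rewrite leq_mul2r leqnSn orbT.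
have dkk : (k.+1 * 2 ^ i - k * 2 ^ i = 2 ^ i)%N by rewrite -mulnBl subSnn mul1n.
have bl : \sum_(w <- words [:: -1; 0; 1] q)
     expR (z * (nth 0 (label_process t (steps_of_word w)) (k.+1 * 2 ^ i)
                - nth 0 (label_process t (steps_of_word w)) (k * 2 ^ i))%:~R)
  <= expR (8 * z ^+ 2 * (K * Q ^+ 2)) * 3 ^+ q.
  apply: label_expR_le => //; first by rewrite le_kk.
  - move=> k' /andP[k1 k2]; rewrite QE mulrA.
    have /= := ct i (k * 2 ^ i)%N k' iI; rewrite k1 (leq_trans k2 kM) /=.
    have -> : (k' - k * 2 ^ i <= 2 ^ i)%N by rewrite -[X in (_ <= X)%N]dkk leq_sub2r.
    move=> /(_ isT isT); rewrite rmorphB /= => /ler_normlP[h _].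
    by move: h; rewrite opprB.
  - move=> k' /andP[k1 k2]; rewrite QE mulrA.
    have /= := ct i k' (k.+1 * 2 ^ i)%N iI; rewrite k2 kM /=.
    have -> : (k.+1 * 2 ^ i - k' <= 2 ^ i)%N by rewrite -[X in (_ <= X)%N]dkk leq_sub2l.
    by move=> /(_ isT isT); rewrite rmorphB /= => /ler_normlP[_ h].
apply: le_trans bl _.
rewrite size_words /= natrX ler_wpM2r ?exprn_ge0 // ler_expR.
have : z ^+ 2 * (16 * K * Q ^+ 2) <= z ^+ 2 * (16 * K ^+ 2 * Q ^+ 2).
  rewrite ler_wpM2l ?sqr_ge0 // ler_wpM2r ?sqr_ge0 //; nra.
by move: (sqr_ge0 z); nra.
Qed.

Lemma next_contour_holder t x I j (X : R) : 1 <= X ->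
  holder (fun k => nth 0 (label_process t x) k)
    (nb_edges t).*2 I (X * scale R j ^+ I) (rate R j) ->
  contour_holder (tree_of_contour (phi_HC (phi_LH (label_process t x)))) I
    (6 * X * scale R j ^+ I) (rate R j).
Proof.
move=> X1 hl; set l := label_process t x in hl *.
set t' := tree_of_heights (phi_LH l).
apply: (@contour_holder_eq t'); first by rewrite /phi_HC contour_tree_of_contour.
have s1 : 1 <= scale R j ^+ I by rewrite exprn_ege1 ?scale_ge1.
case: (tree_of_heightsP (phi_LH l)) => [ht|]; rewrite -/t'; last first.
  move=> ->; apply: contour_holder_leaf; last exact/ltW/rate_gt0.
  by rewrite !mulr_ge0 //; lra.
have tl : (size l).-1 = nb_edges t'.
  by rewrite /nb_edges -(size_map size) -/(heights t') ht /= size_map size_iota.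
have sl : (size l).-1 = (nb_edges t).*2 by rewrite size_label_process.
move=> i s r iI srN rs.
set w := X * scale R j ^+ I * rate R j ^+ (I - i).
(* This turns the bound 4w + 2 of [contour_osc_le] into 6w. *)
have w1 : 1 <= w.
  rewrite /w -mulrA; have := scale_rate_pow_ge1 R j I i; set u := _ * _ ^+ _; nra.
have -> : 6 * X * scale R j ^+ I * rate R j ^+ (I - i) = 6 * w by rewrite /w; ring.
apply: le_trans (contour_osc_le (m := 2 ^ i) (w := w) ht _ tl _ _ _ _ srN rs) _.
- by rewrite expn_gt0.
- by rewrite size_label_process.
- exact: label_process_first.
- by rewrite sl label_process_last.
- by move=> a b; rewrite sl => ab d; exact: hl.
- by lra.
Qed.

Lemma nb_edges_next t x :
  (nb_edges (tree_of_contour (phi_HC (phi_LH (label_process t x)))) <= (nb_edges t).*2)%N.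
Proof.
rewrite (contour_nb_edges (contour_tree_of_contour _)).
case: (tree_of_heightsP (phi_LH (label_process t x))) => [ht|-> //].
rewrite /nb_edges -(size_map size) -/(heights _) ht /= size_map size_iota.
by rewrite size_label_process.
Qed.

Lemma level_tree_ext c x y j :
  (forall i k, (1 <= i <= j)%N -> (1 <= k <= nb_edges (level_tree c x i.-1))%N ->
     x i k = y i k) ->
  level_tree c x j = level_tree c y j.
Proof.
elim: j => [|j IH] // xy; rewrite /level_tree /= -!/(level_tree _ _ _).
rewrite -IH; last by move=> i k /andP[i1 ij]; apply: xy; rewrite i1 leqW.
congr (tree_of_contour (phi_HC (phi_LH _))); apply: label_process_ext => k hk.
by apply: xy; rewrite ?ltnSn.
Qed.

Lemma level_treeS c x j : level_tree c x j.+1 =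
  tree_of_contour (phi_HC (phi_LH (label_process (level_tree c x j) (x j.+1)))).
Proof. by []. Qed.

Lemma nb_edges_level_tree c x j :
  (nb_edges (level_tree c x j) <= 2 ^ j * nb_edges (tree_of_contour c))%N.
Proof.
elim: j => [|j IH]; first by rewrite expn0 mul1n.
rewrite level_treeS; apply: leq_trans (nb_edges_next _ _) _.
by rewrite expnS -mulnA mul2n leq_double.
Qed.

End OneLevel.

(** * Iteration of the levels *)


(* An outcome is C^(1) together with the words of label steps of the levels
   1, ..., j, which are stored at the positions 0, ..., j-1. *)
Fixpoint outcomes (n j : nat) : seq (seq nat * seq (seq int)) :=
  if j is j'.+1 then
    [seq (o.1, rcons o.2 w) |
      o <- outcomes n j', w <- words [:: -1; 0; 1] (snake_size n j'.+1)]
  else [seq (c, [::]) | c <- dycks n].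

Definition outcome_steps (o : seq nat * seq (seq int)) (j k : nat) : int :=
  steps_of_word (nth [::] o.2 j.-1) k.

Lemma outcomesP n j o : o \in outcomes n j ->
  [/\ o.1 \in dycks n, size o.2 = j & forall i, (i < j)%N ->
     nth [::] o.2 i \in words [:: -1; 0; 1] (snake_size n i.+1)].
Proof.
elim: j o => [|j IH] o /=; first by case/mapP => c cd ->.
case/allpairsP => [[u w] [/= uo wW ->]] /=; have [h1 h2 h3] := IH _ uo.
split; rewrite ?size_rcons ?h2 // => i; rewrite ltnS nth_rcons h2.
by case: ltngtP => // [ij _|->]; [exact: h3|].
Qed.

Lemma uniq_outcomes n j : uniq (outcomes n j).
Proof.
elim: j => [|j IH] /=; first by rewrite map_inj_uniq ?uniq_dycks // => ? ? [].
apply: allpairs_uniq => //; first by apply: uniq_words.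
move=> [[c xs] w] [[c' xs'] w'] _ _ /= [-> e].
by move/rcons_inj: e => [-> ->].
Qed.

Lemma nb_edges_dyck n c : c \in dycks n -> (nb_edges (tree_of_contour c) <= n)%N.
Proof.
rewrite mem_dycks => /andP[/dyck_nth[sc _ _ _] _].
case: (tree_of_contourP c) => [h|-> //].
by have := size_contour (tree_of_contour c); rewrite h sc => -[] /(congr1 half); rewrite !doubleK => ->.
Qed.

Lemma outcome_steps_rcons o w i k :
  (1 <= i <= size o.2)%N -> outcome_steps (o.1, rcons o.2 w) i k = outcome_steps o i k.
Proof.
move=> /andP[i0 io]; rewrite /outcome_steps /= nth_rcons.
by rewrite (_ : (i.-1 < size o.2)%N) // prednK.
Qed.

Lemma level_tree_rcons n j o w : o \in outcomes n j ->
  level_tree o.1 (outcome_steps (o.1, rcons o.2 w)) j.+1 =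
  tree_of_contour (phi_HC (phi_LH
    (label_process (level_tree o.1 (outcome_steps o) j) (steps_of_word w)))).
Proof.
move=> /outcomesP[_ so _]; rewrite level_treeS.
have -> : level_tree o.1 (outcome_steps (o.1, rcons o.2 w)) j = level_tree o.1 (outcome_steps o) j.
  by apply: level_tree_ext => i k hi _; rewrite outcome_steps_rcons ?so.
congr (tree_of_contour (phi_HC (phi_LH _))); apply: label_process_ext => k _.
by rewrite /outcome_steps /= nth_rcons so ltnn eqxx.
Qed.

Section Levels.
Variable R : realType.

Lemma le_fcount_in (T : eqType) (W : seq T) (Q Q' : T -> Prop) :
  (forall w, w \in W -> Q w -> Q' w) -> fcount R W Q <= fcount R W Q'.
Proof.
move=> QQ; rewrite /fcount big_seq [leRHS]big_seq; apply: ler_sum => w /QQ h.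
by rewrite ler_nat; case: (asboolP (Q w)) => // /h /asboolP ->.
Qed.

Lemma nb_edges_outcome n j o : o \in outcomes n j ->
  (nb_edges (level_tree o.1 (outcome_steps o) j) <= 2 ^ j * n)%N.
Proof.
move=> /outcomesP[cd _ _]; apply: leq_trans (nb_edges_level_tree _ _ _) _.
by rewrite leq_mul2l nb_edges_dyck // orbT.
Qed.

(** The contour at level j+1 has at most 2^(j+1) n steps; the extra factor 2 required of 2^I makes
    room for the 2n+1 letters of the bridge at the first level. *)
Lemma level_holder_le (j : nat) (e : R) : 0 < e ->
  exists2 K : R, 1 <= K & forall n I, (0 < n)%N -> (2 ^ j.+2 * n <= 2 ^ I)%N ->
    fcount R (outcomes n j) (fun o =>
      ~ contour_holder (level_tree o.1 (outcome_steps o) j) I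
          (K * scale R j.+1 ^+ I) (rate R j.+1))
    <= e * (size (outcomes n j))%:R.
Proof.
elim: j e => [|j IH] e e0.
  have [X X1 hX] := dyck_holder_le e0; exists X => // n I n0 nI.
  rewrite /fcount /= big_map size_map.
  apply: le_trans (hX n I n0 _); last by apply: leq_trans nI; lia.
  apply: le_fcount_in => c cd nh hc; apply: nh.
  rewrite /level_tree /=; case: (tree_of_contourP c) => [ec|->].
    move: cd; rewrite mem_dycks => /andP[/dyck_nth[sc _ _ _] _].
    rewrite /contour_holder ec; suff -> : (nb_edges (tree_of_contour c)).*2 = n.*2 by [].
    by have := size_contour (tree_of_contour c); rewrite ec sc => -[].
  apply: contour_holder_leaf; last exact/ltW/rate_gt0.
  by rewrite mulr_ge0 ?exprn_ge0 ?(ltW (scale_gt0 _ _)) //; lra.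
(* One half pays for bad trees at the previous level, the other for bad words on a good tree. *)
have e2 : 0 < e / 2 by lra.
have [K K1 hK] := IH (e / 2) e2.
have [X X1 hX] := label_holder_le j.+1 K1 e2.
exists (6 * X) => [|n I n0 nI]; first by lra.
have nI' : (2 ^ j.+2 * n <= 2 ^ I)%N.
  by apply: leq_trans nI; rewrite leq_mul2r leq_exp2l // leqnSn orbT.
have {}hK := hK n I n0 nI'.
set W := words [:: -1; 0; 1] (snake_size n j.+1).
rewrite /fcount /= big_allpairs_dep /= size_allpairs -/W natrM.
pose bad o := ~ contour_holder (level_tree o.1 (outcome_steps o) j) I
          (K * scale R j.+1 ^+ I) (rate R j.+1).
apply: (@le_trans _ _ (\sum_(o <- outcomes n j)
   ((`[< bad o >])%:R * (size W)%:R + e / 2 * (size W)%:R))); last first.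
  rewrite big_split /= -mulr_suml big_const_seq iter_addr_0 count_predT.
  rewrite -[X in _ + X <= _]mulr_natr.
  have := ler_wpM2r (_ : 0 <= (size W)%:R :> R) hK => h.
  have {}h := h (ler0n _ _).
  apply: le_trans (lerD h (lexx _)) _.
  by rewrite le_eqVlt; apply/orP; left; apply/eqP; field.
rewrite big_seq [leRHS]big_seq; apply: ler_sum => o oo.
have W0 : 0 <= e / 2 * (size W)%:R by rewrite mulr_ge0 // ltW.
case: asboolP => [_|/contrapT ho]; last first.
  rewrite mul0r add0r.
  have tq := nb_edges_outcome oo.
  have tq' : (nb_edges (level_tree o.1 (outcome_steps o) j) <= snake_size n j.+1)%N by [].
  have tI : ((nb_edges (level_tree o.1 (outcome_steps o) j)).*2 <= 2 ^ I)%N.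
    apply: leq_trans nI'; rewrite -mul2n; apply: (@leq_trans (2 * (2 ^ j * n))%N).
      by rewrite leq_mul2l tq.
    by rewrite mulnA -expnS leq_mul2r leq_exp2l // leqnSn orbT.
  apply: le_trans (hX _ _ _ tq' tI ho).
  apply: le_fcount => w nh hl; apply: nh.
  rewrite (level_tree_rcons w oo); exact: next_contour_holder.
rewrite mul1r -[leLHS]addr0 lerD //.
exact: (fcount_size R W (fun w => ~ contour_holder
  (level_tree o.1 (outcome_steps (o.1, rcons o.2 w)) j.+1) I
  (6 * X * scale R j.+2 ^+ I) (rate R j.+2))).
Qed.

Lemma nb_dyck_gt0 n : (0 < nb_dyck n)%N.
Proof.
rewrite -size_dycks; have := perm_size (perm_rotated_dycks n).
rewrite size_allpairs size_iota size_bridges.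
case: (size _) => //; rewrite mul0n => h.
by have := bin_gt0 n.*2.+1 n; rewrite -h -addnn -addSn leq_addl.
Qed.

(** The second factor is the mass that [snake_lawE] gives to one outcome, so the listed outcomes
    carry the full mass. *)
Lemma size_outcomes n j :
  (size (outcomes n j))%:R *
  ((nb_dyck n)%:R^-1 * \prod_(1 <= i < j.+1) (3%:R^-1) ^+ snake_size n i) = 1 :> R.
Proof.
elim: j => [|j IH] /=.
  rewrite size_map size_dycks big_geq // mulr1 divff //.
  by rewrite pnatr_eq0 -lt0n nb_dyck_gt0.
rewrite size_allpairs size_words /= natrM natrX big_nat_recr //= .
set p := \prod_(1 <= i < j.+1) _ in IH *; set d := _^-1 in IH *.
rewrite -[RHS]IH exprVn; field.
by rewrite expf_neq0 // pnatr_eq0.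
Qed.

End Levels.

(** * Diameter of a feuilletage *)

Section Graph.
Variables (T : nat -> ptree) (L : nat -> seq int) (D : nat).

Let V := vertex (feuilletage T L D).
Let e : rel V := @edge (feuilletage T L D).
Let cl := fold_class T L D.

Lemma feuilletage_edge_parent (x y : V) u :
  u \in nodes (T D) -> u != [::] -> val x = cl u -> val y = cl (parent u) ->
  e x y /\ e y x.
Proof.
move=> ut u0 xu yu; rewrite /e /edge /= /feuilletage_edge xu yu.
by split; apply/hasP; exists u => //; rewrite u0 eqxx ?orbT.
Qed.

Lemma vertex_node (x : V) : exists2 u, u \in nodes (T D) & val x = cl u.
Proof. by have /mapP[u ut ->] := valP x; exists u. Qed.

Lemma node_vertex u : u \in nodes (T D) -> exists x : V, val x = cl u.
Proof. by move=> ut; exists (SeqSub (map_f cl ut)). Qed.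

(** The ancestral line of [u] in the top tree projects to a walk. Both orientations are built
    because [path] follows oriented edges. *)
Lemma walk_to_root u (x r : V) : u \in nodes (T D) ->
  val x = cl u -> val r = cl [::] ->
  (exists p : seq V, [/\ size p = size u, path e x p & last x p = r]) /\
  (exists p : seq V, [/\ size p = size u, path e r p & last r p = x]).
Proof.
move=> + + rE; elim/last_ind: u x => [|u i IH] x ut xE.
  have -> : x = r by apply: val_inj; rewrite xE rE.
  by split; exists [::].
have pE : parent (rcons u i) = u.
  by rewrite /parent size_rcons /= -cats1 take_size_cat.
have ut' : u \in nodes (T D) by rewrite -pE; exact: nodes_take.
have [y yE] := node_vertex ut'.
have [exy eyx] : e x y /\ e y x.
  by apply: (feuilletage_edge_parent ut) => //; rewrite ?pE //; case: (u).
have [[p [ps pp pl]] [q [qs qp ql]]] := IH y ut' yE; split.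
  by exists (y :: p); rewrite /= ps size_rcons exy pp pl.
by exists (rcons q x); rewrite !size_rcons qs rcons_path qp ql eyx last_rcons.
Qed.

Lemma gdist_le (x y : V) (p : seq V) :
  path e x p -> last x p = y -> (gdist x y <= size p)%N.
Proof.
move=> ep lp; rewrite /gdist leqNgt; apply/negP => lt.
(* [find] returns at most [#|V|], even when it fails, so a shorter [p] has its length in the
   searched range. *)
have sN : (size p < size (iota 0 #|V|))%N.
  by apply: leq_trans lt _; exact: find_size.
rewrite size_iota in sN.
have := before_find 0%N lt; rewrite nth_iota // add0n.
suff -> : walk_of_length (size p) x y by [].
by apply/existsP; exists (in_tuple p); rewrite /= lp eqxx andbT.
Qed.

Lemma diam_le (h : nat) : (forall u, u \in nodes (T D) -> (size u <= h)%N) ->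
  (diam (feuilletage T L D) <= 2 * h)%N.
Proof.
move=> hh; apply/bigmax_leqP => x _; apply/bigmax_leqP => y _.
have root : [::] \in nodes (T D) by rewrite nodes_cons mem_head.
have [r rE] := node_vertex root.
have [u ut xE] := vertex_node x; have [v vt yE] := vertex_node y.
have [[p [ps pp pl]] _] := walk_to_root ut xE rE.
have [_ [q [qs qp ql]]] := walk_to_root vt yE rE.
have := @gdist_le x y (p ++ q); rewrite cat_path pp pl qp last_cat pl ql size_cat ps qs.
move/(_ isT erefl)/leq_trans; apply.
by rewrite mul2n -addnn leq_add ?hh.
Qed.

End Graph.

Lemma mem_ups x s : {subset ups x s <= s}.
Proof.
elim: s x => //= y s IH x z; rewrite in_cons; case: ifP => _.
  by rewrite in_cons => /orP[->//|/IH ->]; rewrite orbT.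
by move/IH ->; rewrite orbT.
Qed.

(** The depth of a node is a contour value, compared with the value 0 at time 0 by the Hoelder bound
    at the top scale i = I, where the power of [r] is 1. *)
Lemma node_size_le (R : realType) t I (X r : R) u :
  contour_holder t I X r -> ((nb_edges t).*2 <= 2 ^ I)%N ->
  u \in nodes t -> (size u)%:R <= X.
Proof.
move=> ct tI ut.
have : size u \in contour t.
  have : size u \in heights t by rewrite map_f.
  rewrite heights_contour contour_cons !in_cons => /orP[->//|/mem_ups ->].
  by rewrite orbT.
case/(nthP 0%N) => k; rewrite size_contour ltnS => kN kE.
have := ct I 0%N k (leqnn _); rewrite /= kN subn0 => /(_ isT (leq_trans kN tI)).
rewrite kE subnn expr0 mulr1 contour_cons /= subr0.
exact/le_trans/ler_norm.
Qed.

Lemma fold_class_ext T T' L L' D :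
  (forall j, (1 <= j <= D)%N -> T j = T' j) ->
  (forall j, (1 <= j < D)%N -> L j = L' j) ->
  fold_class T L D = fold_class T' L' D.
Proof.
move=> hT hL; apply: funext; elim: D hT hL => // -[|D] // IH hT hL u.
rewrite /= -!/(fold_class _ _ D.+1 _); case: ifP => // _.
have -> : fold_node T L D.+2 u = fold_node T' L' D.+2 u.
  by rewrite /fold_node /= (hT D.+1) ?(hT D.+2) ?(hL D.+1) //= ?ltnSn ?leqnSn.
apply: IH => j /andP[j1 jD]; [apply: hT|apply: hL]; rewrite j1 //.
  exact: leqW.
exact: ltnW.
Qed.

Lemma feuilletage_ext T T' L L' D : (1 <= D)%N ->
  (forall j, (1 <= j <= D)%N -> T j = T' j) ->
  (forall j, (1 <= j < D)%N -> L j = L' j) ->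
  feuilletage T L D = feuilletage T' L' D.
Proof.
(* The vertex type depends on [T] and [L]; writing the graph as a function of the class map and the
   top tree makes both rewritable. *)
move=> D1 hT hL; pose G (f : node -> nat * node) t := @FGraph (seq_sub (map f (nodes t)))
  (fun x y => has (fun u => (u != [::]) &&
         (((val x, val y) == (f u, f (parent u))) ||
          ((val y, val x) == (f u, f (parent u))))) (nodes t)).
rewrite -[LHS]/(G (fold_class T L D) (T D)) -[RHS]/(G (fold_class T' L' D) (T' D)).
by rewrite (fold_class_ext hT hL) hT // D1 leqnn.
Qed.

(** * From proportions to probabilities *)

Local Open Scope classical_set_scope.

Definition level_labels (c : seq nat) (x : nat -> nat -> int) (j : nat) : seq int :=
  label_process (level_tree c x j.-1) (x j).

Definition level_feuilletage (c : seq nat) (x : nat -> nat -> int) (D : nat) : Defs.fgraph :=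
  feuilletage (fun j => level_tree c x j.-1) (level_labels c x) D.

(** The property reads finitely many letters. Their number is taken from [c] itself rather than from
    n, because the first contour may leave the Dyck paths on a null event, which measurability has
    to cover. *)
Definition local (J : nat) (Q : seq nat -> (nat -> nat -> int) -> Prop) : Prop :=
  forall c x y,
    (forall i k, (1 <= i <= J)%N ->
       (1 <= k <= snake_size (nb_edges (tree_of_contour c)) i)%N -> x i k = y i k) ->
    Q c x -> Q c y.

Lemma local_level_feuilletage D (Q : Defs.fgraph -> Prop) : (1 <= D)%N ->
  local D.-1 (fun c x => Q (level_feuilletage c x D)).
Proof.
move=> D1 c x y xy; suff -> : level_feuilletage c x D = level_feuilletage c y D by [].
have xy' i k : (1 <= i <= D.-1)%N -> (1 <= k <= nb_edges (level_tree c x i.-1))%N -> x i k = y i k.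
  move=> hi /andP[k1 kN]; apply: xy => //; rewrite k1 /=.
  exact: leq_trans kN (nb_edges_level_tree _ _ _).
have tE j : (j <= D.-1)%N -> level_tree c x j = level_tree c y j.
  move=> jD; apply: level_tree_ext => i k /andP[i1 ij]; apply: xy'.
  by rewrite i1 (leq_trans ij).
apply: feuilletage_ext => // j /andP[j1 jD].
  by apply: tE; rewrite -!subn1 leq_sub2r.
have jD' : (j <= D.-1)%N by rewrite -ltnS prednK.
rewrite /level_labels -tE; last exact: leq_trans (leq_pred j) jD'.
by apply: label_process_ext => k; apply: xy'; rewrite j1.
Qed.

Section Snakes.
Variables (R : realType) (d : measure_display) (Om : measurableType d).
Variables (P : probability Om R) (n : nat) (S : iterated_snakes P n).

Let steps (w : Om) (j k : nat) : int := snake_step S j k w.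

Lemma snake_treeE j w : (1 <= j)%N ->
  snake_tree S j w = level_tree (snake_contour S 1 w) (steps w) j.-1.
Proof.
case: j => // j _ /=; elim: j => [//|j IH].
rewrite level_treeS -IH /snake_tree (@snake_contourE _ _ _ _ _ S j.+2 w isT) /=.
by rewrite (@snake_labelE _ _ _ _ _ S j.+1 w isT).
Qed.

Lemma random_feuilletageE D w : (1 <= D)%N ->
  random_feuilletage S D w = level_feuilletage (snake_contour S 1 w) (steps w) D.
Proof.
move=> D1; apply: feuilletage_ext => // j /andP[j1 jD]; first exact: snake_treeE.
by rewrite (@snake_labelE _ _ _ _ _ S j w j1) -/(snake_tree S j w) snake_treeE.
Qed.

Definition cylinder (J N : nat) (c : seq nat) (x : nat -> nat -> int) : set Om :=
  [set w | snake_contour S 1 w = c /\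
     forall j k, (1 <= j <= J)%N -> (1 <= k <= snake_size N j)%N ->
       snake_step S j k w = x j k].

Lemma measurable_cylinder J N c x : measurable (cylinder J N c x).
Proof.
pose F j k : set Om := if (1 <= j <= J)%N && (1 <= k <= snake_size N j)%N
  then [set w | snake_step S j k w = x j k] else setT.
have -> : cylinder J N c x = [set w | snake_contour S 1 w = c] `&` \bigcap_j \bigcap_k F j k.
  apply/seteqP; split => w /= [wc h]; split => //.
    move=> j _ k _; rewrite /F; case: ifP => // /andP[hj hk]; exact: h.
  by move=> j k hj hk; have := h j I k I; rewrite /F hj hk.
apply: measurableI; first exact: snake_contour_measurable.
apply: bigcapT_measurable => j; apply: bigcapT_measurable => k.
by rewrite /F; case: ifP => _; [exact: snake_step_measurable|exact: measurableT].
Qed.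

(** Contours and finite families of words form a countable type, so the event is a countable union
    of cylinders. *)
Lemma measurable_local J Q : local J Q ->
  measurable [set w | Q (snake_contour S 1 w) (steps w)].
Proof.
move=> locQ; pose N (c : seq nat) := nb_edges (tree_of_contour c).
pose F (v : seq nat * seq (seq int)) : set Om :=
  if `[< Q v.1 (outcome_steps v) >] then cylinder J (N v.1) v.1 (outcome_steps v) else set0.
have -> : [set w | Q (snake_contour S 1 w) (steps w)] = \bigcup_v F v.
  apply/seteqP; split => w /=; last first.
    move=> [v _]; rewrite /F; case: asboolP => // Qv [wc h].
    rewrite wc; apply: locQ Qv => i k hi hk; rewrite /steps h //.
  move=> Qw; pose c := snake_contour S 1 w.
  (* The index of the cylinder containing [w]: its contour and the letters that a local property can
     read. *)
  pose v := (c, [seq [seq steps w i k | k <- iota 1 (snake_size (N c) i)] | i <- iota 1 J]).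
  have vE i k : (1 <= i <= J)%N -> (1 <= k <= snake_size (N c) i)%N ->
      steps w i k = outcome_steps v i k.
    move=> /andP[i1 iJ] /andP[k1 kN]; rewrite /outcome_steps /= /steps_of_word.
    have i1' : (i.-1 < J)%N by rewrite prednK.
    have k1' : (k.-1 < snake_size (N c) i)%N by rewrite prednK.
    rewrite (nth_map 0%N) ?size_iota // nth_iota // add1n prednK //.
    by rewrite (nth_map 0%N) ?size_iota // nth_iota // add1n prednK.
  exists v => //; rewrite /F asboolT; last exact: locQ vE Qw.
  by split.
apply: countable_bigcupT_measurable; first exact: countableP.
move=> v; rewrite /F; case: ifP => _; last exact: measurable0.
exact: measurable_cylinder.
Qed.

Lemma outcome_steps_mem j o i k : o \in outcomes n j ->
  outcome_steps o i k \in [:: -1; 0; 1].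
Proof.
move=> /outcomesP[_ so h]; rewrite /outcome_steps /steps_of_word.
have [ij|ij] := ltnP i.-1 j; last by rewrite [nth [::] _ _]nth_default ?so // nth_nil.
have := h _ ij; rewrite mem_words => /andP[_ /allP hw].
have [kk|kk] := ltnP k.-1 (size (nth [::] o.2 i.-1)); last by rewrite nth_default.
exact/hw/mem_nth.
Qed.

Lemma cylinder_outcome_inj J o o' w : o \in outcomes n J -> o' \in outcomes n J ->
  cylinder J n o.1 (outcome_steps o) w -> cylinder J n o'.1 (outcome_steps o') w -> o = o'.
Proof.
move=> oo oo' [c1 h1] [c2 h2].
have [_ s1 w1] := outcomesP oo; have [_ s2 w2] := outcomesP oo'.
have e1 : o.1 = o'.1 by rewrite -c1 -c2.
have e2 : o.2 = o'.2.
  apply: (@eq_from_nth _ [::]); first by rewrite s1 s2.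
  move=> i; rewrite s1 => iJ.
  have := w1 i iJ; have := w2 i iJ; rewrite !mem_words => /andP[/eqP z2 _] /andP[/eqP z1 _].
  apply: (@eq_from_nth _ 0); first by rewrite z1 z2.
  move=> k; rewrite z1 => kN.
  have := h1 i.+1 k.+1 iJ kN; rewrite h2 //.
by case: o o' e1 e2 {oo oo' c1 h1 c2 h2 s1 w1 s2 w2} => [? ?] [? ?] /= -> ->.
Qed.

Let weight (J : nat) : R :=
  (nb_dyck n)%:R^-1 * \prod_(1 <= j < J.+1) (3%:R^-1) ^+ snake_size n j.

Lemma prob_cylinders J (G : seq (seq nat * seq (seq int))) :
  uniq G -> {subset G <= outcomes n J} ->
  P (\bigcup_(o in [set` G]) cylinder J n o.1 (outcome_steps o))
  = ((size G)%:R * weight J)%:E.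
Proof.
rewrite bigcup_seq; elim: G => [|o G IH] /=.
  by rewrite big_nil measure0 mul0r.
move=> /andP[oG uG] sub; rewrite big_cons.
have oo : o \in outcomes n J by apply: sub; rewrite mem_head.
have sub' : {subset G <= outcomes n J} by move=> z zG; apply: sub; rewrite in_cons zG orbT.
have [cd _ _] := outcomesP oo.
have dc : is_dyck n o.1 by move: cd; rewrite mem_dycks => /andP[].
have Po : P (cylinder J n o.1 (outcome_steps o)) = (weight J)%:E.
  by apply: snake_lawE => // j k; exact: outcome_steps_mem oo.
rewrite -[(size (o :: G))%:R]natr1 mulrDl mul1r addrC EFinD -Po -(IH uG sub').
apply: measureU.
- exact: measurable_cylinder.
- by apply: bigsetU_measurable => z _; exact: measurable_cylinder.
- rewrite -bigcup_seq; apply/seteqP; split => // w [wo [z zG wz]].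
  have zG' : z \in G by [].
  have := cylinder_outcome_inj oo (sub' _ zG') wo wz.
  by move=> e; move: oG; rewrite e zG'.
Qed.

(** The event is bounded through its complement, which contains the disjoint cylinders of the
    outcomes outside [Q]. As all outcomes together have mass 1, points outside every cylinder are
    accounted for. *)
Lemma prob_local_le J Q (e : R) : local J Q ->
  fcount R (outcomes n J) (fun o => Q o.1 (outcome_steps o))
    <= e * (size (outcomes n J))%:R ->
  (P [set w | Q (snake_contour S 1 w) (steps w)] <= e%:E)%E.
Proof.
move=> locQ hQ; set A := [set w | _].
have mA : measurable A by exact: measurable_local locQ.
pose q (o : seq nat * seq (seq int)) := `[< Q o.1 (outcome_steps o) >].
pose G := [seq o <- outcomes n J | ~~ q o].
have uG : uniq G by exact/filter_uniq/uniq_outcomes.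
have sG : {subset G <= outcomes n J} by move=> o; rewrite mem_filter => /andP[].
have PG := prob_cylinders uG sG.
have GA : \bigcup_(o in [set` G]) cylinder J n o.1 (outcome_steps o) `<=` ~` A.
  move=> w [v /= vG [wc h]] Qw; have vo := sG _ vG.
  move: vG; rewrite mem_filter => /andP[/asboolP nQ _]; apply: nQ.
  have [cd _ _] := outcomesP vo.
  move: Qw; rewrite /A /= wc; apply: locQ => i k hi /andP[k1 kN].
  rewrite /steps h // k1 /=; apply: leq_trans kN _.
  by rewrite /snake_size leq_mul2l nb_edges_dyck ?orbT.
have mG : measurable (\bigcup_(o in [set` G]) cylinder J n o.1 (outcome_steps o)).
  by rewrite bigcup_seq; apply: bigsetU_measurable => z _; exact: measurable_cylinder.
have le1 : (((size G)%:R * weight J)%:E <= P (~` A))%E.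
  by rewrite -PG; apply: le_measure => //; rewrite inE //; exact: measurableC.
have PA : P A = (1 - P (~` A))%E.
  by rewrite -[in LHS](setCK A) probability_setC //; exact: measurableC.
have sum1 : fcount R (outcomes n J) (fun o => Q o.1 (outcome_steps o)) + (size G)%:R
    = (size (outcomes n J))%:R.
  rewrite /fcount size_filter -sum1_count natr_sum [X in _ + X]big_mkcond /= -big_split /=.
  rewrite -[in RHS]sum1_size natr_sum; apply: eq_bigr => o _.
  by rewrite /q; case: `[< _ >]; rewrite /= ?addr0 ?add0r.
have w1 := size_outcomes R n J; rewrite -/(weight J) in w1.
have w0 : 0 <= weight J.
  rewrite mulr_ge0 ?invr_ge0 //; apply: prodr_ge0 => i _.
  by rewrite exprn_ge0 // invr_ge0.
rewrite PA; apply: (@le_trans _ _ (1 - ((size G)%:R * weight J)%:E)%E).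
  exact: leeB.
rewrite -[1%E]/(1%:E) -EFinB lee_fin -w1 -mulrBl.
have := ler_wpM2r w0 hQ; rewrite -mulrA w1 mulr1; apply: le_trans.
by rewrite ler_wpM2r // -sum1 addrK.
Qed.

End Snakes.

(** * Tightness of the rescaled diameters *)

Lemma feuilletage_diam_tail (R : realType) (D : nat) (e : R) :
  (1 <= D)%N -> 0 < e ->
  exists2 M : R, 0 <= M &
    forall (d : measure_display) (Om : measurableType d) (P : probability Om R)
      (n : nat) (S : iterated_snakes P n) (Q : Defs.fgraph -> Prop), (0 < n)%N ->
    (forall G, Q G -> M * n%:R `^ (2 ^+ D)^-1 < (diam G)%:R) ->
    (P [set w | Q (random_feuilletage S D w)] <= e%:E)%E.
Proof.
move=> D1 e0; have [K K1 hK] := level_holder_le D.-1 e0.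
pose a : R := (2 ^+ D)^-1.
have a0 : 0 <= a by rewrite invr_ge0 exprn_ge0.
(* The 2 is the two walks to the root, [K] the Hoelder constant, and the last factor comes from 2^I
   <= 2^(D+2) n. *)
exists (2 * K * (2 ^ D.+2)%:R `^ a).
  by rewrite !mulr_ge0 ?powR_ge0 //; lra.
move=> d Om P n S Q n0 hQ.
have -> : [set w | Q (random_feuilletage S D w)]
    = [set w | Q (level_feuilletage (snake_contour S 1 w)
                    (fun j k => snake_step S j k w) D)].
  by apply/seteqP; split => w /=; rewrite random_feuilletageE.
apply: (prob_local_le S (local_level_feuilletage (D := D) D1)).
(* The choice places 2^I between 2^(D+1) n and 2^(D+2) n. *)
pose I := (trunc_log 2 n + D.+2)%N.
have nI : (2 ^ D.-1.+2 * n <= 2 ^ I)%N.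
  have -> : I = (D.+1 + (trunc_log 2 n).+1)%N by rewrite /I; lia.
  by rewrite prednK // expnD leq_mul2l ltnW ?orbT // trunc_log_ltn.
have In : (2 ^ I <= 2 ^ D.+2 * n)%N.
  by rewrite /I expnD mulnC leq_mul2l trunc_logP ?orbT.
apply: le_trans (hK n I n0 nI); apply: le_fcount_in => o oo Qo ho.
have := hQ _ Qo; apply/negP; rewrite -leNgt.
rewrite prednK // in ho.
set X := K * scale R D ^+ I in ho.
have X0 : 0 <= X by rewrite mulr_ge0 ?exprn_ge0 ?(ltW (scale_gt0 _ _)) //; lra.
have tI : ((nb_edges (level_tree o.1 (outcome_steps o) D.-1)).*2 <= 2 ^ I)%N.
  apply: leq_trans nI; rewrite -mul2n expnS -mulnA leq_mul2l /=.
  apply: leq_trans (nb_edges_outcome oo) _.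
  by rewrite leq_mul2r leq_exp2l // leqnSn orbT.
have dX : (diam (level_feuilletage o.1 (outcome_steps o) D)
    <= 2 * Num.trunc X)%N.
  apply: diam_le => u ut; rewrite truncn_ge_nat //.
  exact: node_size_le ho tI ut.
apply: (@le_trans _ _ (2 * X)).
  apply: (@le_trans _ _ (2 * Num.trunc X)%:R); first by rewrite ler_nat.
  by rewrite natrM ler_wpM2l // truncn_le.
rewrite /X scale_expn -/a -!mulrA ler_wpM2l // ler_wpM2l //; first by lra.
rewrite -powRM // -natrM; apply: ge0_ler_powR => //; rewrite ?nnegrE // ler_nat.
exact: In.
Qed.

Lemma tight_scaled_diam (R : realType) (D : nat) (d : nat -> measure_display)
    (Om : forall n, measurableType (d n)) (P : forall n, probability (Om n) R)
    (S : forall n, iterated_snakes (P n) n.+1) (b : nat -> R) (B : R) :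
  (1 <= D)%N -> (forall n, 0 <= b n) ->
  (forall n, b n * n.+1%:R `^ (2 ^+ D)^-1 <= B) ->
  tight P (fun n w => b n * (diam (random_feuilletage (S n) D w))%:R).
Proof.
move=> D1 b0 bB e e0; have [M M0 hM] := feuilletage_diam_tail D1 e0.
exists `[0, M * B]; first exact: segment_compact.
move=> n; set A := _ @^-1` _.
pose Q (G : Defs.fgraph) := (~` `[0, M * B]) (b n * (diam G)%:R).
have -> : A = [set w | Q (random_feuilletage (S n) D w)] by [].
apply: hM => // G; rewrite /Q /= in_itv /= mulr_ge0 //= => /negP.
rewrite -ltNge => h; rewrite ltNge; apply/negP => h'.
move: h; apply/negP; rewrite -leNgt.
apply: le_trans (ler_wpM2l (b0 n) h') _.
by rewrite mulrCA ler_wpM2l.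
Qed.

Theorem mainTheorem4 (R : realType) (D : nat) (hD : (1 <= D)%N)
    (d : nat -> measure_display) (Om : forall n, measurableType (d n))
    (P : forall n, probability (Om n) R)
    (S : forall n, iterated_snakes (P n) n.+1) :
  tight P (fun n w =>
    (alpha R n.+1 D)^-1 * (diam (random_feuilletage (S n) D w))%:R)
  /\
  tight P (fun n w =>
    n.+1%:R `^ (- (2 ^+ D)^-1) * (diam (random_feuilletage (S n) D w))%:R).
Proof.
have pos (n : nat) : 0 < n.+1%:R `^ (2 ^+ D)^-1 :> R by rewrite powR_gt0.
split.
(* The normalization [alpha] is n^(1/2^D) up to the constant factor [c]. *)
- pose c : R := 2 `^ (2 ^+ D)^-1 * (2 / 3) `^ (1 - (2 ^+ D.-1)^-1).
  have c0 : 0 < c by rewrite mulr_gt0 ?powR_gt0 //; lra.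
  have aE n : alpha R n.+1 D = n.+1%:R `^ (2 ^+ D)^-1 * c.
    by rewrite /alpha powRM // /c; ring.
  apply: (@tight_scaled_diam R D d Om P S (fun n => (alpha R n.+1 D)^-1) c^-1) => // n; rewrite aE.
    by rewrite invr_ge0 mulr_ge0 ?ltW.
  by rewrite invfM mulrAC mulVf ?mul1r // gt_eqF.
- apply: (@tight_scaled_diam R D d Om P S (fun n => n.+1%:R `^ (- (2 ^+ D)^-1)) 1) => // n.
  by rewrite powRN mulVf // gt_eqF.
Qed.
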